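(* Let $(\Omega,\mathcal H,\widehat{\mathbb E})$ be a sub-linear expectation space satisfying condition (CC), and let $\{X_n;n\ge1\}$ be a sequence of $m$-dependent and linear stationary random variables in it. Let $S_n=\sum_{i=1}^nX_i$. If there exists a real number $M$ such that $$\widehat{\mathbb V}^*\left(\limsup_{n\to\infty}\frac{|S_n|}{\sqrt{2n\log\log n}}\ge M\right)<1,$$ then $$C_{\mathbb V}\left[\frac{X_1^2}{\log\log|X_1|}\right]<\infty$$ and $$\lim_{n\to\infty}\frac{\breve{\mathbb E}[S_n]}{n}=\lim_{n\to\infty}\frac{\breve{\mathcal E}[S_n]}{n}=0.$$
   Context: Setting. $(\Omega,\mathcal F)$ is a measurable space and $\mathcal H$ is a linear space of real measurable functions on $(\Omega,\mathcal F)$ such that $\varphi(X_1,\dots,X_n)\in\mathcal H$ whenever $X_1,\dots,X_n\in\mathcal H$ and $\varphi\in C_{l,Lip}(\mathbb R^n)$, where $C_{l,Lip}(\mathbb R^n)$ is the space of functions with $|\varphi(x)-\varphi(y)|\le C(1+|x|^k+|y|^k)|x-y|$ for some $C>0,k\in\mathbb N$ depending on $\varphi$. $C_{b,Lip}(\mathbb R^n)$ denotes bounded Lipschitz functions. A sub-linear expectation is a map $\widehat{\mathbb E}:\mathcal H\to[-\infty,\infty]$ which is monotone, preserves constants, is sub-additive ($\widehat{\mathbb E}[X+Y]\le\widehat{\mathbb E}[X]+\widehat{\mathbb E}[Y]$ whenever the right side is not $\infty-\infty$ or $-\infty+\infty$), and is positively homogeneous ($\widehat{\mathbb E}[\lambda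 X]=\lambda\widehat{\mathbb E}[X]$ for $\lambda\ge0$, with $0\cdot\infty=0$). $(\Omega,\mathcal H,\widehat{\mathbb E})$ is then a sub-linear expectation space. Truncated expectation. For $c>0$, $X^{(c)}=(-c)\vee X\wedge c$; $\breve{\mathbb E}[X]=\lim_{c\to\infty}\widehat{\mathbb E}[X^{(c)}]$ if the limit exists, and $\breve{\mathcal E}[X]=-\breve{\mathbb E}[-X]$. Distribution and dependence. Random variables (or vectors) $X,Y$ are identically distributed, $X\overset{d}{=}Y$, if $\widehat{\mathbb E}[\varphi(X)]=\widehat{\mathbb E}[\varphi(Y)]$ for all $\varphi\in C_{b,Lip}$. $\bm Y$ is independent to (of) $\bm X$ if $\widehat{\mathbb E}[\varphi(\bm X,\bm Y)]=\widehat{\mathbb E}\big[\widehat{\mathbb E}[\varphi(\bm x,\bm Y)]|_{\bm x=\bm X}\big]$ for all bounded Lipschitz $\varphi$. $\{X_n\}$ is $m$-dependent ($m$ a nonnegative integer) if for every $n$ and every $j\ge m+1$, $(X_{n+m+1},\dots,X_{n+j})$ is independent of $(X_1,\dots,X_n)$. $\{X_n\}$ is linear stationary if $X_1+\cdots+X_n\overset{d}{=}X_{1+p}+\cdots+X_{n+p}$ for all positive integers $n,p$. Condition (CC). Let $\mathcal H_b=\{f\in\mathcal H: f\text{ bounded}\}$. $\widehat{\mathbb E}$ satisfies (CC) if $\widehat{\mathbb E}[X]=\sup_{P\in\mathcal P}P[X]$ for all $X\in\mathcal H_b$ (with $P[X]=\int X\,dP$), for some family $\mathcal P$ of probability measures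 on $(\Omega,\sigma(\mathcal H))$ that is countable-dimensionally weakly compact: for any $Y_1,Y_2,\dots\in\mathcal H_b$ and any sequence $\{P_n\}\subset\mathcal P$ there are a subsequence $\{n_k\}$ and $P\in\mathcal P$ with $\lim_k P_{n_k}[\varphi(Y_1,\dots,Y_d)]=P[\varphi(Y_1,\dots,Y_d)]$ for all $\varphi\in C_{b,Lip}(\mathbb R^d)$, $d\ge1$. Capacities. $\mathbb V:\mathcal F\to[0,1]$ is a sub-additive capacity ($\mathbb V(A\cup B)\le\mathbb V(A)+\mathbb V(B)$) satisfying $\widehat{\mathbb E}[f]\le\mathbb V(A)\le\widehat{\mathbb E}[g]$ whenever $f\le I_A\le g$, $f,g\in\mathcal H$, $A\in\mathcal F$. The Choquet integral is $C_{\mathbb V}[X]=\int_0^\infty\mathbb V(X\ge t)\,dt+\int_{-\infty}^0[\mathbb V(X\ge t)-1]\,dt$ (its value for $X\in\mathcal H$ does not depend on the choice of such $\mathbb V$). For $A\in\mathcal F$: $\widehat{\mathbb V}(A)=\inf\{\widehat{\mathbb E}[\xi]: I_A\le\xi,\ \xi\in\mathcal H\}$ and $\widehat{\mathbb V}^*(A)=\inf\{\sum_{n=1}^\infty\widehat{\mathbb V}(A_n): A\subset\bigcup_{n=1}^\infty A_n,\ A_n\in\mathcal F\}$. Convention. $\log x=\ln\max(e,x)$. *)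

(* Defs.v *)
From HB Require Import structures.
From mathcomp Require Import all_boot all_order all_algebra.
From mathcomp Require Import all_classical all_reals all_analysis.

Set Implicit Arguments.
Unset Strict Implicit.
Unset Printing Implicit Defensive.

Import Order.TTheory GRing.Theory Num.Theory.
Import numFieldNormedType.Exports.

Local Open Scope classical_set_scope.
Local Open Scope ring_scope.

Section function_spaces.
Context {R : realType} {n : nat}.
Implicit Types (x : 'rV[R]_n) (phi : 'rV[R]_n -> R).

(* The library norm on row vectors is the maximum norm. *)
Definition euclid_norm x : R := Num.sqrt (\sum_(i < n) x ord0 i ^+ 2).

Definition C_lLip phi : Prop :=
  exists (C : R) (k : nat), 0 < C /\
    forall x y, `|phi x - phi y| <=
      C * (1 + euclid_norm x ^+ k + euclid_norm y ^+ k) * euclid_norm (x - y).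

Definition C_bLip phi : Prop :=
  (exists C : R, forall x, `|phi x| <= C) /\
  (exists L : R, forall x y, `|phi x - phi y| <= L * euclid_norm (x - y)).

End function_spaces.

Definition random_vector {R : realType} {T : Type} {n : nat}
  (X : 'I_n -> T -> R) (w : T) : 'rV[R]_n := \row_(i < n) X i w.

Section sublinear_expectation.
Context {R : realType} {d : measure_display} {Omega : measurableType d}.
Implicit Types (H : set (Omega -> R)) (E : (Omega -> R) -> \bar R).
Implicit Types (X Y : Omega -> R) (A B : set Omega) (V : set Omega -> R).

Record rv_space H : Prop := RVSpace {
  rv_space_measurable : forall X, H X -> measurable_fun setT X ;
  rv_space_zero : H (fun=> 0) ;
  rv_space_add : forall X Y, H X -> H Y -> H (fun w => X w + Y w) ;
  rv_space_scale : forall (a : R) X, H X -> H (fun w => a * X w) ;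
  rv_space_comp : forall (n : nat) (X : 'I_n -> Omega -> R)
      (phi : 'rV[R]_n -> R),
    (forall i, H (X i)) -> C_lLip phi -> H (phi \o random_vector X) }.

(* [E] is only meaningful on [H]; its values elsewhere are never used. The
   library convention [0 * +oo = 0] is the one required for homogeneity, and
   [E X +? E Y] excludes exactly the sums oo - oo and - oo + oo. *)
Record sublinear_expectation H E : Prop := SublinearExpectation {
  sublinear_monotone : forall X Y, H X -> H Y ->
    (forall w, X w <= Y w) -> (E X <= E Y)%E ;
  sublinear_cst : forall c : R, E (fun=> c) = c%:E ;
  sublinear_subadd : forall X Y, H X -> H Y -> (E X +? E Y)%E ->
    (E (fun w => X w + Y w)%R <= E X + E Y)%E ;
  sublinear_homogeneous : forall (a : R) X, 0 <= a -> H X ->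
    E (fun w => a * X w)%R = (a%:E * E X)%E }.

Definition truncate (c : R) X : Omega -> R :=
  fun w => Num.max (- c) (Num.min (X w) c).

(* [breveE E X] is junk when the limit does not exist, hence the separate
   existence predicate. *)
Definition has_breveE E X : Prop := cvg (E (truncate c X) @[c --> +oo%R]).

Definition breveE E X : \bar R := lim (E (truncate c X) @[c --> +oo%R]).

Definition breve_calE E X : \bar R := (- breveE E (fun w => - X w)%R)%E.

Definition identically_distributed E (n : nat)
    (X Y : 'I_n -> Omega -> R) : Prop :=
  forall phi : 'rV[R]_n -> R, C_bLip phi ->
    E (phi \o random_vector X) = E (phi \o random_vector Y).

(* [Y] is independent to [X]. The inner expectation is that of a bounded
   random variable, hence finite, so that [fine] loses nothing. *)
Definition independent_to E (p q : nat) (X : 'I_p -> Omega -> R)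
    (Y : 'I_q -> Omega -> R) : Prop :=
  forall phi : 'rV[R]_(p + q) -> R, C_bLip phi ->
    E (fun w => phi (row_mx (random_vector X w) (random_vector Y w))) =
    E (fun w => fine
      (E (fun w' => phi (row_mx (random_vector X w) (random_vector Y w'))))).

(* Sequences are indexed from 0: [X i] stands for X_(i+1). Hence the blocks
   below are (X_1, ..., X_n) and (X_(n+m+1), ..., X_(n+j)). *)
Definition m_dependent E (m : nat) (X : nat -> Omega -> R) : Prop :=
  forall n j : nat, (0 < n)%N -> (m.+1 <= j)%N ->
    independent_to E (fun i : 'I_n => X i)
                     (fun i : 'I_(j - m) => X (n + m + i)%N).

Definition linear_stationary E (X : nat -> Omega -> R) : Prop :=
  forall n p : nat, (0 < n)%N -> (0 < p)%N ->
    identically_distributed E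
      (fun (_ : 'I_1) w => \sum_(i < n) X i w)
      (fun (_ : 'I_1) w => \sum_(i < n) X (i + p)%N w).

Definition partial_sum (X : nat -> Omega -> R) (n : nat) : Omega -> R :=
  fun w => \sum_(i < n) X i w.

Definition bounded_part H : set (Omega -> R) :=
  [set X | H X /\ exists C : R, forall w, `|X w| <= C].

Definition sigma_rv_gen H : set (set Omega) :=
  [set A | exists X (B : set R), [/\ H X, measurable B & A = X @^-1` B]].

(* Omega equipped with sigma(H), the smallest sigma-algebra for which all the
   elements of [H] are measurable. *)
Definition sigma_rv H := g_sigma_algebraType (sigma_rv_gen H).

Definition prob_mean H (P : probability (sigma_rv H) R) X : \bar R :=
  (\int[P]_(w in [set: sigma_rv H]) (X w)%:E)%E.

Definition countable_dim_weakly_compact H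
    (PP : set (probability (sigma_rv H) R)) : Prop :=
  forall (Y : nat -> Omega -> R) (P : nat -> probability (sigma_rv H) R),
    (forall i, bounded_part H (Y i)) -> (forall n, PP (P n)) ->
    exists (nk : nat -> nat) (Q : probability (sigma_rv H) R),
      [/\ {homo nk : i j / (i < j)%N}, PP Q &
        forall (e : nat) (phi : 'rV[R]_e -> R), (0 < e)%N -> C_bLip phi ->
          prob_mean (P (nk k)) (phi \o random_vector (fun i : 'I_e => Y i))
            @[k --> \oo] -->
          prob_mean Q (phi \o random_vector (fun i : 'I_e => Y i))].

Definition condition_CC H E : Prop :=
  exists PP : set (probability (sigma_rv H) R),
    countable_dim_weakly_compact PP /\
    forall X, bounded_part H X ->
      E X = ereal_sup [set prob_mean P X | P in PP].

Record subadditive_capacity V : Prop := SubadditiveCapacity {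
  capacity_bounds : forall A, measurable A -> 0 <= V A <= 1 ;
  capacity_set0 : V set0 = 0 ;
  capacity_setT : V setT = 1 ;
  capacity_monotone : forall A B, measurable A -> measurable B ->
    A `<=` B -> V A <= V B ;
  capacity_subadd : forall A B, measurable A -> measurable B ->
    V (A `|` B) <= V A + V B }.

Definition capacity_compatible H E V : Prop :=
  forall A (f g : Omega -> R), measurable A -> H f -> H g ->
    (forall w, f w <= \1_A w) -> (forall w, \1_A w <= g w) ->
    (E f <= (V A)%:E)%E /\ ((V A)%:E <= E g)%E.

Definition choquet V X : \bar R :=
  (\int[lebesgue_measure]_(t in `[0%R, +oo[) (V [set w | (t <= X w)%R])%:E +
   \int[lebesgue_measure]_(t in `]-oo, 0%R])
     (V [set w | (t <= X w)%R] - 1)%:E)%E.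

Definition hatV H E A : \bar R :=
  ereal_inf [set E xi | xi in [set xi | H xi /\ forall w, \1_A w <= xi w]].

Definition hatV_star H E A : \bar R :=
  ereal_inf [set (\sum_(0 <= n <oo) hatV H E (B n))%E |
    B in [set B : nat -> set Omega |
      (forall n, measurable (B n)) /\ A `<=` \bigcup_n B n]].

End sublinear_expectation.

(* The convention log x = ln (max (e, x)). *)
Definition logM {R : realType} (x : R) : R := ln (Num.max (expR 1) x).

(* Main.v *)
Require Import Defs.
From mathcomp Require Import all_boot all_order all_algebra.
From mathcomp Require Import all_classical all_reals all_analysis.
From mathcomp Require Import measurable_realfun ring lra zify.

Set Implicit Arguments.
Unset Strict Implicit.
Unset Printing Implicit Defensive.

Import Order.TTheory GRing.Theory Num.Theory.
Import numFieldNormedType.Exports.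

Local Open Scope classical_set_scope.
Local Open Scope ring_scope.

(** Why the theorem holds.

    Work with the lower expectation - E[-Y] of bounded variables. On functionals
    of index blocks separated by gaps of m indices it is additive, and
    multiplicative on nonnegative functionals ([clower_sum_blocks],
    [clower_prod_blocks]). Suppose that Z_0, Z_1, ... are nonnegative functionals
    of successive separated blocks whose lower expectations are at most 2^-k.
    Their sums then have bounded lower expectation, and the weak compactness in
    (CC) yields one probability Q of the family under which the sum of all the
    Q[Z_k] is finite; hence Z_k < 1/2 eventually, Q-almost surely. An event of
    outer capacity less than 1 cannot have full Q-measure, so some point outside
    of the event satisfies Z_k < 1/2 eventually ([avoid_by_blocks]). Applied to
    the event of the theorem, this gives a path along which
    |S_n| <= D sqrt (2 n log log n) for all large n, while the Z_k prescribe what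
    happens infinitely often. Both conclusions follow by choosing Z_k so as to
    contradict this growth.

    Moment condition. Let f_i be a Lipschitz substitute for the indicator of
    |x| > 2 D a_i with a_i = sqrt (2 n log log n), n = (m + 1) (i + 1). If the
    series of the E[f_i(X_1)] diverged, the products of the factors
    1 - f_i(X_((m + 1) (i + 1))) over long ranges of i would have small lower
    expectation; taking them as Z_k forces |X_n| > 2 D a_i infinitely often,
    although X_n is a difference of two partial sums. So the series converges
    ([tail_mean_summable]). It dominates the Choquet integral of
    X_1^2 / log log |X_1| ([choquet_lt_pinfty]), and, the a_i growing at most
    linearly, it makes the expected excess of |X_1| over c tend to 0
    ([uniform_tail_of_summable]). By stationarity the same holds for S_n, so that
    the truncated means of S_n converge ([truncated_mean_cvg]).

    Vanishing drift. Let mu_p and nu_p be the limits for S_p and - S_p. Since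
    mu_p + nu_p >= 0, it is enough that mu_p <= delta p for all large p, for every
    delta > 0; the same statement for - X bounds nu_p. If mu_p > delta p for
    arbitrarily large p, cut a very long block into q sums of p consecutive terms
    separated by gaps of length m, and truncate these sums to W_j. The lower
    expectation of the product of the 1 - lam (W_j - delta p / 4) decays
    geometrically in q, whereas a small value of this product forces the sum of
    the W_j to be at least a multiple of q p. The gaps and the truncation errors
    are added to the functional as a small penalty ([exists_drifting_block]).
    With these functionals as Z_k, some path has linearly growing block sums,
    against the growth bound ([truncated_mean_limit_le]). *)

(** * Truncation and excess of real numbers *)

(** The comparisons are introduced only at the end: a minimum nested in another
    one then still occurs in the goal when its turn comes. *)
Ltac case_min_max := rewrite ?minEle ?maxEle;
  repeat match goal with
  | |- context [if (?x <= ?y)%O then _ else _] => case: (leP x y)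
  | |- context [Num.norm ?x] => case: (ger0P x)
  end; move=> *.

Section truncations.
Context {R : realType}.
Implicit Types (c K u v : R).

Definition clip c u : R := Num.max (- c) (Num.min u c).

(** The cut-off at K keeps the excess of |u| over c bounded, so that only
    expectations of bounded variables are ever compared. *)
Definition excess c K u : R := Num.min (Num.max (`|u| - c) 0) K.


Definition bLip (g : R -> R) : Prop :=
  (exists C : R, forall u, `|g u| <= C) /\
  (exists L : R, 0 <= L /\ forall u v, `|g u - g v| <= L * `|u - v|).

Lemma norm_bounds (x : R) : exists d : R, [/\ `|x| = d, x <= d & - x <= d].
Proof. by exists `|x|; rewrite ler_norm -normrN ler_norm. Qed.

Lemma dist_max_le (a x y : R) : `|Num.max a x - Num.max a y| <= `|x - y|.
Proof.
have [d [-> h1 h2]] := norm_bounds (x - y); rewrite ler_norml. 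
by case: (leP a x) => h3; case: (leP a y) => h4; apply/andP; split; lra.
Qed.

Lemma dist_min_le (a x y : R) : `|Num.min x a - Num.min y a| <= `|x - y|.
Proof.
have [d [-> h1 h2]] := norm_bounds (x - y); rewrite ler_norml. 
by case: (leP x a); case: (leP y a) => *; apply/andP; split; lra.
Qed.
Lemma norm_clip c u : 0 <= c -> `|clip c u| <= c.
Proof.
move=> c0; rewrite ler_norml /clip le_max lexx/= ge_max ge_min lexx orbT andbT.
lra.
Qed.

Lemma clip_lip c u v : `|clip c u - clip c v| <= `|u - v|.
Proof. exact: le_trans (dist_max_le _ _ _) (dist_min_le _ _ _). Qed.

Lemma clipN c u : 0 <= c -> clip c (- u) = - clip c u.
Proof. by move=> c0; rewrite /clip; (case_min_max; lra). Qed.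

Lemma excess_ge0 c K u : 0 <= K -> 0 <= excess c K u.
Proof. by move=> K0; rewrite /excess le_min le_max lexx orbT. Qed.

Lemma excess_le c K u : excess c K u <= K.
Proof. by rewrite /excess ge_min lexx orbT. Qed.

Lemma excess_lip c K u v : `|excess c K u - excess c K v| <= `|u - v|.
Proof.
apply: le_trans (dist_min_le _ _ _) _.
rewrite ![Num.max _ 0]maxC; apply: le_trans (dist_max_le _ _ _) _.
by rewrite opprD opprK addrACA addNr addr0 ler_dist_dist.
Qed.

Lemma excess_le_left c c' K u : c <= c' -> excess c' K u <= excess c K u.
Proof.
move=> cc; rewrite /excess le_min ge_min [X in _ && X]ge_min lexx orbT andbT.
by rewrite ge_max !le_max lexx orbT lerD2l lerN2 cc.
Qed.



Lemma clip_id c u : `|u| <= c -> clip c u = u.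
Proof.
by rewrite ler_norml /clip => /andP[h1 h2]; rewrite min_l// max_r.
Qed.

Lemma clip_excess c c' u : 0 <= c <= c' ->
  `|clip c u - clip c' u| <= excess c c' u.
Proof.
move=> /andP[c0 cc]; have c'0 : 0 <= c' by lra.
wlog u0 : u / 0 <= u.
  move=> h; case: (ger0P u) => u0; first exact: h.
  have := h (- u); rewrite !clipN// /excess normrN.
  by rewrite opprK addrC distrC; apply; lra.
have cE x : 0 <= x -> clip x u = Num.min u x.
  by move=> x0; rewrite /clip max_r// le_min; apply/andP; split; lra.
rewrite !cE// distrC /excess (ger0_norm u0).
rewrite ger0_norm; last by case_min_max; lra.
by case: (leP u c); case_min_max; lra.
Qed.

(** As long as the cut-off K is not attained, the excess is exactly the error
    made by truncating at c. *)
Lemma norm_sub_clip c K u : 0 <= c -> excess c K u < K ->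
  `|u - clip c u| = excess c K u.
Proof.
move=> c0; wlog u0 : u / 0 <= u.
  move=> h; case: (ger0P u) => u0; first exact: h.
  have := h (- u); rewrite !clipN// /excess normrN.
  by rewrite -opprD normrN => {}h k; apply: h => //; lra.
rewrite /clip max_r; last by rewrite le_min; apply/andP; split; lra.
rewrite /excess (ger0_norm u0) => h.
rewrite ger0_norm; last by case_min_max; lra.
by move: h; case_min_max; lra.
Qed.

Lemma excessD c c' K u v : 0 <= K ->
  excess (c + c') K (u + v) <= excess c K u + excess c' K v.
Proof.
move=> K0; rewrite /excess.
have : `|u + v| <= `|u| + `|v| by exact: ler_normD.
have [a [-> _ _]] := norm_bounds u; have [b [-> _ _]] := norm_bounds v.
have [d [-> _ _]] := norm_bounds (u + v) => h.
have {}h : Num.max (d - (c + c')) 0 <= Num.max (a - c) 0 + Num.max (b - c') 0.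
  by (case_min_max; lra).
have : 0 <= Num.max (a - c) 0 by rewrite le_max lexx orbT.
have : 0 <= Num.max (b - c') 0 by rewrite le_max lexx orbT.
move: h; set x := Num.max _ _; set y := Num.max (a - c) 0; set z := Num.max (b - c') 0.
by clearbody x y z; (case_min_max; lra).
Qed.

Lemma excess_sum c K n (u : nat -> R) : 0 <= K -> 0 <= c ->
  excess (n%:R * c) K (\sum_(i < n) u i) <= \sum_(i < n) excess c K (u i).
Proof.
move=> K0 c0; elim: n => [|n ih].
  by rewrite !big_ord0 /excess normr0; case_min_max; lra.
rewrite !big_ord_recr/= -natr1 mulrDl mul1r.
exact: le_trans (excessD _ _ _ _ K0) (lerD ih _).
Qed.

Lemma bLip_clip c : 0 <= c -> bLip (clip c).
Proof.
move=> c0; split; first by exists c => u; exact: norm_clip.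
by exists 1; split=> // u v; rewrite mul1r clip_lip.
Qed.

Lemma bLip_excess c K : 0 <= K -> bLip (excess c K).
Proof.
move=> K0; split; last by exists 1; split=> // u v; rewrite mul1r excess_lip.
by exists K => u; rewrite ger0_norm ?excess_ge0// excess_le.
Qed.

Lemma bLip_affine (a b : R) g : bLip g -> bLip (fun u => a + b * g u).
Proof.
move=> [[C gC] [L [L0 gL]]]; split.
  exists (`|a| + `|b| * C) => u; rewrite (le_trans (ler_normD _ _))// lerD2l.
  by rewrite normrM ler_wpM2l.
exists (`|b| * L); split=> [|u v]; first by rewrite mulr_ge0.
rewrite opprD addrACA subrr add0r -mulrBr normrM.
by rewrite -mulrA ler_wpM2l.
Qed.

End truncations.

(** * Bounded Lipschitz functionals of finitely many coordinates *)

Section cylinder_functionals.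
Context {R : realType}.
Implicit Types (x y : nat -> R) (F G : (nat -> R) -> R) (a b : nat).

(** Functionals on sequences, rather than functions of a row vector: those of
    different blocks then live in one type and can be added and multiplied. *)
Definition cyl a b F : Prop :=
  (exists C : R, forall x, `|F x| <= C) /\
  (exists L : R, 0 <= L /\
    forall x y, `|F x - F y| <= L * \sum_(a <= i < b) `|x i - y i|).

Lemma cyl_local a b F x y : cyl a b F ->
  (forall i, (a <= i < b)%N -> x i = y i) -> F x = F y.
Proof.
move=> [_ [L [_ FL]]] xy; apply/eqP; rewrite -subr_eq0 -normr_le0.
rewrite (le_trans (FL x y))// big_nat big1 ?mulr0// => i ab.
by rewrite xy// subrr normr0.
Qed.

Lemma cyl_widen a b a' b' F : (a' <= a)%N -> (b <= b')%N ->
  cyl a b F -> cyl a' b' F.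
Proof.
move=> aa bb [FC [L [L0 FL]]]; split=> //; exists L; split=> // x y.
rewrite (le_trans (FL x y))// ler_wpM2l//.
have [ab|ba] := leqP a b; last by rewrite big_geq ?sumr_ge0// ltnW.
rewrite [in leRHS](big_cat_nat aa (leq_trans ab bb))/=.
rewrite [X in _ + X](big_cat_nat ab bb)/=.
by rewrite addrCA lerDl addr_ge0 ?sumr_ge0.
Qed.

Lemma cyl_cst a b (c : R) : cyl a b (fun=> c).
Proof.
split; first by exists `|c|.
by exists 0; split=> // x y; rewrite subrr normr0 mul0r.
Qed.

Lemma cylD a b F G : cyl a b F -> cyl a b G -> cyl a b (fun x => F x + G x).
Proof.
move=> [[C FC] [L [L0 FL]]] [[C' GC] [L' [L'0 GL]]]; split.
  by exists (C + C') => x; rewrite (le_trans (ler_normD _ _))// lerD.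
exists (L + L'); split=> [|x y]; first exact: addr_ge0.
by rewrite opprD addrACA (le_trans (ler_normD _ _))// mulrDl lerD.
Qed.

Lemma cylM a b F G : cyl a b F -> cyl a b G -> cyl a b (fun x => F x * G x).
Proof.
move=> [[C FC] [L [L0 FL]]] [[C' GC] [L' [L'0 GL]]]; split.
  by exists (C * C') => x; rewrite normrM ler_pM.
have C0 : 0 <= C by exact: le_trans (FC (fun=> 0)).
have C'0 : 0 <= C' by exact: le_trans (GC (fun=> 0)).
exists (C * L' + C' * L); split=> [|x y]; first by rewrite addr_ge0// mulr_ge0.
have -> : F x * G x - F y * G y = F x * (G x - G y) + G y * (F x - F y) by ring.
rewrite (le_trans (ler_normD _ _))// mulrDl !normrM -!mulrA.
by rewrite lerD// ler_pM.
Qed.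

Lemma cylN a b F : cyl a b F -> cyl a b (fun x => - F x).
Proof.
move=> /(cylM (cyl_cst a b (- 1 : R))).
by under eq_fun do rewrite mulN1r.
Qed.

Lemma cyl_sum a b (n : nat) (F : nat -> (nat -> R) -> R) :
  (forall j, (j < n)%N -> cyl a b (F j)) -> cyl a b (fun x => \sum_(j < n) F j x).
Proof.
elim: n => [|n ih] Fc.
  by under eq_fun do rewrite big_ord0; exact: cyl_cst.
under eq_fun do rewrite big_ord_recr/=.
by apply: cylD; [apply: ih => j jn; apply: Fc; exact: ltnW|exact: Fc].
Qed.

Lemma cyl_prod a b (n : nat) (F : nat -> (nat -> R) -> R) :
  (forall j, (j < n)%N -> cyl a b (F j)) ->
  cyl a b (fun x => \prod_(j < n) F j x).
Proof.
elim: n => [|n ih] Fc.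
  by under eq_fun do rewrite big_ord0; exact: cyl_cst.
under eq_fun do rewrite big_ord_recr/=.
by apply: cylM; [apply: ih => j jn; apply: Fc; exact: ltnW|exact: Fc].
Qed.

Definition block_sum a b x : R := \sum_(a <= i < b) x i.

Lemma cyl_block_sum a b g : bLip g -> cyl a b (fun x => g (block_sum a b x)).
Proof.
move=> [[C gC] [L [L0 gL]]]; split; first by exists C.
exists L; split=> // x y; rewrite (le_trans (gL _ _))// ler_wpM2l//.
by rewrite /block_sum -sumrB ler_norm_sum.
Qed.

Lemma cyl_coordinate g (j : nat) : bLip g -> cyl j j.+1 (fun x => g (x j) : R).
Proof.
move=> /(cyl_block_sum j j.+1).
by under eq_fun do rewrite /block_sum big_nat1.
Qed.

End cylinder_functionals.

Section row_vectors.
Context {R : realType}.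

Lemma le_euclid_norm (n : nat) (x : 'rV[R]_n) (i : 'I_n) :
  `|x ord0 i| <= euclid_norm x.
Proof.
rewrite -sqrtr_sqr ler_wsqrtr// (bigD1 i)//= lerDl sumr_ge0// => j _.
exact: sqr_ge0.
Qed.

Lemma C_bLip_C_lLip (n : nat) (phi : 'rV[R]_n -> R) : C_bLip phi -> C_lLip phi.
Proof.
move=> [_ [L phiL]]; exists (`|L| + 1), 0%N; split=> [|x y].
  by rewrite ltr_wpDl.
rewrite (le_trans (phiL x y))// !expr0.
have e0 : 0 <= euclid_norm (x - y) by exact: sqrtr_ge0.
rewrite ler_wpM2r//.
have := ler_norm L; have := normr_ge0 L; move: `|L| => l; lra.
Qed.

(** Padding by 0; a functional that only looks at the first n coordinates does
    not see it. *)
Definition seq_of_row (n : nat) (v : 'rV[R]_n) (i : nat) : R :=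
  oapp (v ord0) 0 (insub i).

Lemma seq_of_rowE (n : nat) (v : 'rV[R]_n) (i : 'I_n) :
  seq_of_row v i = v ord0 i.
Proof. by rewrite /seq_of_row valK. Qed.

Lemma C_bLip_cyl (n : nat) (F : (nat -> R) -> R) :
  cyl 0 n F -> C_bLip (fun v : 'rV[R]_n => F (seq_of_row v)).
Proof.
move=> [[C FC] [L [L0 FL]]]; split; first by exists C.
exists (L * n%:R) => u v; rewrite (le_trans (FL _ _))// -mulrA ler_wpM2l//.
rewrite big_mkord mulr_natl -[X in _ *+ X]card_ord -sumr_const.
apply: ler_sum => i _; rewrite !seq_of_rowE.
by rewrite (le_trans _ (le_euclid_norm _ i))// !mxE.
Qed.

End row_vectors.

(** * Means of bounded random variables *)

Section means.
Context {R : realType} {d : measure_display} {Omega : measurableType d}.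
Variables (H : set (Omega -> R)) (E : (Omega -> R) -> \bar R).
Hypotheses (rvH : rv_space H) (subE : sublinear_expectation H E).
Implicit Types (Y Z W : Omega -> R).

(** Meaningful on bounded variables, where E is finite. *)
Definition mean Y : R := fine (E Y).

Lemma rv_cst (c : R) : H (fun=> c).
Proof.
have -> : (fun=> c) = (fun=> c) \o random_vector (fun (_ : 'I_1) (_ : Omega) => 0 : R).
  exact: funext.
apply: rv_space_comp => //; first by move=> _; exact: rv_space_zero.
exists 1, 0%N; split=> // x y.
by rewrite subrr normr0 !expr0 mulr_ge0 ?sqrtr_ge0.
Qed.

Lemma bounded_cst (c : R) : bounded_part H (fun=> c).
Proof. by split; [exact: rv_cst|exists `|c|]. Qed.

Lemma boundedD Y Z : bounded_part H Y -> bounded_part H Z ->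
  bounded_part H (fun w => Y w + Z w).
Proof.
move=> [HY [C YC]] [HZ [C' ZC]]; split; first exact: rv_space_add.
by exists (C + C') => w; rewrite (le_trans (ler_normD _ _))// lerD.
Qed.

Lemma boundedZ (a : R) Y : bounded_part H Y -> bounded_part H (fun w => a * Y w).
Proof.
move=> [HY [C YC]]; split; first exact: rv_space_scale.
by exists (`|a| * C) => w; rewrite normrM ler_wpM2l.
Qed.

Lemma boundedN Y : bounded_part H Y -> bounded_part H (fun w => - Y w).
Proof.
by move=> /(boundedZ (-1)); under eq_fun do rewrite mulN1r.
Qed.

Lemma bounded_sum (n : nat) (Y : nat -> Omega -> R) :
  (forall i, (i < n)%N -> bounded_part H (Y i)) ->
  bounded_part H (fun w => \sum_(i < n) Y i w).
Proof.
elim: n => [|n ih] HY.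
  by under eq_fun do rewrite big_ord0; exact: bounded_cst.
under eq_fun do rewrite big_ord_recr/=.
by apply: boundedD; [apply: ih => i /ltnW; exact: HY|exact: HY].
Qed.

Lemma bounded_comp (g : R -> R) Y : bLip g -> H Y ->
  bounded_part H (fun w => g (Y w)).
Proof.
move=> [[C gC] [L [L0 gL]]] HY; split; last by exists C.
have -> : (fun w => g (Y w)) =
    (fun v : 'rV[R]_1 => g (v ord0 ord0)) \o random_vector (fun=> Y).
  by apply: funext => w /=; rewrite mxE.
apply: rv_space_comp => //; apply: C_bLip_C_lLip; split; first by exists C.
exists L => x y; rewrite (le_trans (gL _ _))// ler_wpM2l//.
by rewrite (le_trans _ (le_euclid_norm _ ord0))// !mxE.
Qed.

Lemma mean_fin Y : bounded_part H Y -> E Y = (mean Y)%:E.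
Proof.
move=> [HY [C YC]]; rewrite fineK// fin_numE.
have h1 : (E Y <= C%:E)%E.
  rewrite -(sublinear_cst subE C); apply: (sublinear_monotone subE) => //.
    exact: rv_cst.
  by move=> w; rewrite (le_trans (ler_norm _)).
have h2 : ((- C)%:E <= E Y)%E.
  rewrite -(sublinear_cst subE (- C)); apply: (sublinear_monotone subE) => //.
    exact: rv_cst.
  by move=> w; have := YC w; rewrite ler_norml => /andP[].
by move: h1 h2; case: (E Y).
Qed.

Lemma mean_le Y Z : bounded_part H Y -> bounded_part H Z ->
  (forall w, Y w <= Z w) -> mean Y <= mean Z.
Proof.
move=> bY bZ YZ; rewrite -lee_fin -!mean_fin//.
by apply: (sublinear_monotone subE) YZ; [case: bY|case: bZ].
Qed.

Lemma mean_cst (c : R) : mean (fun=> c) = c.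
Proof. by rewrite /mean (sublinear_cst subE). Qed.

Lemma meanD Y Z : bounded_part H Y -> bounded_part H Z ->
  mean (fun w => Y w + Z w) <= mean Y + mean Z.
Proof.
move=> bY bZ; rewrite -lee_fin EFinD -!mean_fin//; last exact: boundedD.
apply: (sublinear_subadd subE); [by case: bY|by case: bZ|].
by rewrite !mean_fin.
Qed.

Lemma meanZ (a : R) Y : 0 <= a -> bounded_part H Y ->
  mean (fun w => a * Y w) = a * mean Y.
Proof.
move=> a0 bY; rewrite /mean (sublinear_homogeneous subE)//; last by case: bY.
by rewrite mean_fin.
Qed.

Lemma mean_addc (c : R) Y : bounded_part H Y ->
  mean (fun w => c + Y w) = c + mean Y.
Proof.
move=> bY; have bc := bounded_cst c; have bcY := boundedD bc bY.
apply/eqP; rewrite eq_le; apply/andP; split.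
  by rewrite (le_trans (meanD _ _))// mean_cst.
rewrite -lerBrDl addrC -[- c]mean_cst.
apply: le_trans (meanD (bounded_cst (- c)) bcY).
rewrite le_eqVlt; apply/orP; left; apply/eqP; congr mean.
by apply: funext => w; rewrite addrA addNr add0r.
Qed.

Lemma mean_sum (n : nat) (Y : nat -> Omega -> R) :
  (forall i, (i < n)%N -> bounded_part H (Y i)) ->
  mean (fun w => \sum_(i < n) Y i w) <= \sum_(i < n) mean (Y i).
Proof.
elim: n => [|n ih] bY.
  by under eq_fun do rewrite big_ord0; rewrite big_ord0 mean_cst.
under eq_fun do rewrite big_ord_recr/=; rewrite big_ord_recr/=.
have bY' i : (i < n)%N -> bounded_part H (Y i) by move=> /ltnW; exact: bY.
by rewrite (le_trans (meanD (bounded_sum bY') (bY _ _)))// lerD2r ih.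
Qed.

Lemma mean_ge0 Y : bounded_part H Y -> (forall w, 0 <= Y w) -> 0 <= mean Y.
Proof.
by move=> bY Y0; rewrite -[leLHS]mean_cst mean_le//; exact: bounded_cst.
Qed.

Lemma dist_mean_le Y Z W : bounded_part H Y -> bounded_part H Z ->
  bounded_part H W -> (forall w, `|Y w - Z w| <= W w) ->
  `|mean Y - mean Z| <= mean W.
Proof.
move=> bY bZ bW YZW.
have le_add Y' Z' : bounded_part H Y' -> bounded_part H Z' ->
    (forall w, `|Y' w - Z' w| <= W w) -> mean Y' - mean Z' <= mean W.
  move=> bY' bZ' YZ'; rewrite lerBlDl (le_trans _ (meanD _ _))//.
  apply: mean_le => //; first exact: boundedD.
  by move=> w; rewrite -lerBlDl (le_trans (ler_norm _)).
rewrite ler_norml lerNl opprB !le_add// => w.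
by rewrite distrC.
Qed.

Lemma mean_add_meanN_ge0 Y : bounded_part H Y ->
  0 <= mean Y + mean (fun w => - Y w).
Proof.
move=> bY; rewrite -[leLHS]mean_cst.
apply: le_trans (meanD bY (boundedN bY)).
rewrite le_eqVlt; apply/orP; left; apply/eqP; congr mean.
by apply: funext => w; rewrite subrr.
Qed.

(** The conjugate (super-linear) expectation. *)
Definition lower Y : R := - mean (fun w => - Y w).

Lemma lowerD_le Y Z : bounded_part H Y -> bounded_part H Z ->
  lower (fun w => Y w + Z w) <= lower Y + mean Z.
Proof.
move=> bY bZ; rewrite /lower lerNl opprD opprK lerBlDr.
have bYZ := boundedN (boundedD bY bZ).
apply: le_trans (meanD bYZ bZ).
apply: mean_le; [exact: boundedN|exact: boundedD|move=> w; lra].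
Qed.

End means.

(** * Independence of separated blocks *)

Section row_mx_sequences.
Context {R : realType}.

Lemma seq_of_row_mx_left (p q : nat) (u : 'rV[R]_p) (v : 'rV[R]_q) (i : nat) :
  (i < p)%N -> seq_of_row (row_mx u v) i = seq_of_row u i.
Proof.
move=> ip; rewrite -[i]/(val (lshift q (Ordinal ip))) seq_of_rowE row_mxEl.
by rewrite -[RHS]/(seq_of_row u (val (Ordinal ip))) seq_of_rowE.
Qed.

Lemma seq_of_row_mx_right (p q : nat) (u : 'rV[R]_p) (v : 'rV[R]_q) (i : nat) :
  (i < q)%N -> seq_of_row (row_mx u v) (p + i)%N = seq_of_row v i.
Proof.
move=> iq; rewrite -[(p + i)%N]/(val (rshift p (Ordinal iq))) seq_of_rowE.
by rewrite row_mxEr -[RHS]/(seq_of_row v (val (Ordinal iq))) seq_of_rowE.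
Qed.

Lemma seq_of_random_vector (T : Type) (X : nat -> T -> R) (k p i : nat) w :
  (i < p)%N ->
  seq_of_row (random_vector (fun i : 'I_p => X (k + i)%N) w) i = X (k + i)%N w.
Proof.
by move=> ip; rewrite -[i]/(val (Ordinal ip)) seq_of_rowE mxE.
Qed.

End row_mx_sequences.

Section independence.
Context {R : realType} {d : measure_display} {Omega : measurableType d}.
Variables (H : set (Omega -> R)) (E : (Omega -> R) -> \bar R).
Variables (m : nat) (X : nat -> Omega -> R).
Hypotheses (rvH : rv_space H) (subE : sublinear_expectation H E).
Hypotheses (HX : forall n, H (X n)) (mdepX : m_dependent E m X).
Implicit Types (F G : (nat -> R) -> R).

Definition path_of (w : Omega) : nat -> R := fun i => X i w.

Lemma bounded_cyl a b F : cyl a b F -> bounded_part H (fun w => F (path_of w)).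
Proof.
move=> Fab; split; last by case: Fab => [[C FC] _]; exists C.
have F0b := cyl_widen (leq0n a) (leqnn b) Fab.
have -> : (fun w => F (path_of w)) =
    (fun v : 'rV[R]_b => F (seq_of_row v)) \o random_vector (fun i : 'I_b => X i).
  apply: funext => w /=; apply: cyl_local F0b _ => i /= ib.
  by rewrite (@seq_of_random_vector _ _ X 0).
apply: rv_space_comp => //; apply: C_bLip_C_lLip; exact: C_bLip_cyl.
Qed.

(** m-dependence, transported from functions of row vectors to functionals: the
    second argument of D is shifted by m so that the gap of m unused indices
    disappears from the vector that concatenates the two blocks. *)
Lemma mean_independent (n j : nat) (D : (nat -> R) -> (nat -> R) -> R) :
  (0 < n)%N -> (m < j)%N ->
  (exists C : R, forall x y, `|D x y| <= C) ->
  (exists L : R, 0 <= L /\ forall x y x' y', `|D x y - D x' y'| <=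
     L * (\sum_(0 <= i < n) `|x i - x' i| +
          \sum_(n + m <= i < n + j) `|y i - y' i|)) ->
  mean E (fun w => D (path_of w) (path_of w)) =
  mean E (fun w => mean E (fun w' => D (path_of w) (path_of w'))).
Proof.
move=> n0 mj [C DC] [L [L0 DL]].
pose G (z : nat -> R) := D z (fun i => z (i - m)%N).
have cG : cyl 0 (n + (j - m)) G.
  split; first by exists C => z; exact: DC.
  exists L; split=> // z z'; rewrite (le_trans (DL _ _ _ _))// ler_wpM2l//.
  rewrite [leRHS](big_cat_nat (leq0n n) (leq_addr _ _))/= lerD2l.
  have -> : (n + j = n + (j - m) + m)%N by rewrite -addnA subnK// ltnW.
  by rewrite big_addn addnK; under eq_bigr do rewrite addnK.
have GD w w' : G (seq_of_row (row_mx (random_vector (fun i : 'I_n => X i) w)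
    (random_vector (fun i : 'I_(j - m) => X (n + m + i)%N) w'))) =
    D (path_of w) (path_of w').
  apply/eqP; rewrite -subr_eq0 -normr_le0 (le_trans (DL _ _ _ _))//.
  rewrite big_nat big1 => [|i /= ni]; last first.
    by rewrite seq_of_row_mx_left// (@seq_of_random_vector _ _ X 0)// subrr normr0.
  rewrite add0r big_nat big1 ?mulr0// => i /= /andP[nmi inj].
  have [k ik] : exists k, i = (n + m + k)%N.
    by exists (i - (n + m))%N; rewrite subnKC.
  have kj : (k < j - m)%N by rewrite ltn_subRL -(ltn_add2l n) addnA -ik.
  rewrite ik (_ : n + m + k - m = n + k)%N; last by rewrite addnAC addnK.
  by rewrite seq_of_row_mx_right// seq_of_random_vector// subrr normr0.
have := mdepX n0 mj (C_bLip_cyl cG); rewrite /mean => indep.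
have -> : (fun w => D (path_of w) (path_of w)) = (fun w => G (seq_of_row
    (row_mx (random_vector (fun i : 'I_n => X i) w)
    (random_vector (fun i : 'I_(j - m) => X (n + m + i)%N) w)))).
  by apply: funext => w; rewrite GD.
rewrite indep; congr (fine (E _)); apply: funext => w; congr (fine (E _)).
by apply: funext => w'; rewrite GD.
Qed.

Definition cmean F : R := mean E (fun w => F (path_of w)).

Definition clower F : R := lower E (fun w => F (path_of w)).

(** Given the first block, the inner expectation is F + E[G], and constants
    leave E. *)
Lemma cmeanD_independent n j F G : (0 < n)%N -> (m < j)%N ->
  cyl 0 n F -> cyl (n + m) (n + j) G ->
  cmean (fun x => F x + G x) = cmean F + cmean G.
Proof.
move=> n0 mj cF cG; have bG := bounded_cyl cG.
rewrite /cmean (mean_independent (D := fun x y => F x + G y) n0 mj).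
- rewrite addrC -(mean_addc rvH subE _ (bounded_cyl cF)).
  congr mean; apply: funext => w.
  by rewrite (mean_addc rvH subE _ bG) addrC.
- case: cF cG => [[C FC] _] [[C' GC] _]; exists (C + C') => x y.
  by rewrite (le_trans (ler_normD _ _))// lerD.
- case: cF cG => [_ [L [L0 FL]]] [_ [L' [L'0 GL]]].
  exists (L + L'); split=> [|x y x' y']; first exact: addr_ge0.
  rewrite opprD addrACA (le_trans (ler_normD _ _))// mulrDr lerD//.
    by rewrite (le_trans (FL _ _))// ler_wpM2r ?sumr_ge0// lerDl.
  by rewrite (le_trans (GL _ _))// ler_wpM2r ?sumr_ge0// lerDr.
Qed.

(** Given the first block, F >= 0 leaves the inner expectation, which becomes
    F times minus the lower expectation of G; the latter is nonnegative, so it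
    leaves the outer expectation. *)
Lemma clowerM_independent n j F G : (0 < n)%N -> (m < j)%N ->
  (forall x, 0 <= F x) -> (forall x, 0 <= G x) ->
  cyl 0 n F -> cyl (n + m) (n + j) G ->
  clower (fun x => F x * G x) = clower F * clower G.
Proof.
move=> n0 mj F0 G0 cF cG; have bG := bounded_cyl cG; have bF := bounded_cyl cF.
have lG : 0 <= clower G.
  rewrite /clower /lower oppr_ge0 -(mean_cst subE 0).
  apply: (mean_le rvH subE); [exact: boundedN|exact: bounded_cst|].
  by move=> w; rewrite oppr_le0.
rewrite /clower {1 2}/lower.
rewrite (mean_independent (D := fun x y => - (F x * G y)) n0 mj).
- rewrite mulNr; congr (- _); rewrite mulrC -(meanZ rvH subE lG (boundedN rvH bF)).
  congr mean; apply: funext => w.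
  have -> : (fun w' => - (F (path_of w) * G (path_of w'))) =
      (fun w' => F (path_of w) * - G (path_of w')).
    by apply: funext => w'; rewrite mulrN.
  rewrite (meanZ rvH subE (F0 _) (boundedN rvH bG)) /clower /lower; ring.
- case: cF cG => [[C FC] _] [[C' GC] _]; exists (C * C') => x y.
  by rewrite normrN normrM ler_pM.
- case: cF cG => [[C FC] [L [L0 FL]]] [[C' GC] [L' [L'0 GL]]].
  have C0 : 0 <= C by exact: le_trans (FC (fun=> 0)).
  have C'0 : 0 <= C' by exact: le_trans (GC (fun=> 0)).
  exists (C * L' + C' * L); split=> [|x y x' y'].
    by rewrite addr_ge0// mulr_ge0.
  have -> : - (F x * G y) - - (F x' * G y') =
      - (G y * (F x - F x')) - F x' * (G y - G y') by ring.
  rewrite (le_trans (ler_normB _ _))// normrN !normrM mulrDr lerD//.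
    rewrite (@le_trans _ _ (C' * (L * \sum_(0 <= i < n) `|x i - x' i|)))//.
      by rewrite ler_pM.
    by rewrite mulrA ler_wpM2r ?sumr_ge0// lerDr mulr_ge0.
  rewrite (@le_trans _ _ (C * (L' * \sum_(n + m <= i < n + j) `|y i - y' i|)))//.
    by rewrite ler_pM.
  by rewrite mulrA ler_wpM2r ?sumr_ge0// lerDl mulr_ge0.
Qed.

Lemma clower_sum_blocks (N : nat -> nat) (F : nat -> (nat -> R) -> R) (K : nat) :
  (0 < N 0)%N -> (forall k, N k + m < N k.+1)%N ->
  (forall k, cyl (N k + m) (N k.+1) (F k)) ->
  clower (fun x => \sum_(k < K) F k x) = \sum_(k < K) clower (F k).
Proof.
move=> N0 NS cF.
have NK k : (0 < N k)%N by case: k => // k; exact: leq_trans (NS k).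
have cS k : cyl 0 (N k) (fun x => \sum_(i < k) F i x).
  elim: k => [|k ih]; first by under eq_fun do rewrite big_ord0; exact: cyl_cst.
  under eq_fun do rewrite big_ord_recr/=; apply: cylD.
    by apply: cyl_widen ih => //; rewrite (leq_trans (leq_addr m _))// ltnW.
  exact: cyl_widen (cF k).
elim: K => [|K ih].
  rewrite big_ord0 /clower /lower; under eq_fun do rewrite big_ord0 oppr0.
  by rewrite (mean_cst subE) oppr0.
rewrite big_ord_recr/= -ih /clower /lower.
have -> : (fun w => - \sum_(k < K.+1) F k (path_of w)) = (fun w =>
    (fun x => - \sum_(k < K) F k x) (path_of w) + (fun x => - F K x) (path_of w)).
  by apply: funext => w; rewrite big_ord_recr/= opprD.
rewrite -opprD; congr (- _).
have mj : (m < N K.+1 - N K)%N by rewrite ltn_subRL.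
apply: (cmeanD_independent (G := fun x => - F K x) (NK K) mj (cylN (cS K))).
rewrite subnKC; first exact: cylN.
by rewrite (leq_trans (leq_addr m _))// ltnW.
Qed.

Lemma clower_prod_blocks (N : nat -> nat) (F : nat -> (nat -> R) -> R) (K : nat) :
  (0 < N 0)%N -> (forall k, N k + m < N k.+1)%N ->
  (forall k, cyl (N k + m) (N k.+1) (F k)) ->
  (forall k x, 0 <= F k x) ->
  clower (fun x => \prod_(k < K) F k x) = \prod_(k < K) clower (F k).
Proof.
move=> N0 NS cF F0.
have NK k : (0 < N k)%N by case: k => // k; exact: leq_trans (NS k).
have cS k : cyl 0 (N k) (fun x => \prod_(i < k) F i x).
  elim: k => [|k ih]; first by under eq_fun do rewrite big_ord0; exact: cyl_cst.
  under eq_fun do rewrite big_ord_recr/=; apply: cylM.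
    by apply: cyl_widen ih => //; rewrite (leq_trans (leq_addr m _))// ltnW.
  exact: cyl_widen (cF k).
elim: K => [|K ih].
  rewrite big_ord0 /clower /lower; under eq_fun do rewrite big_ord0.
  by rewrite (mean_cst subE) opprK.
rewrite big_ord_recr/= -ih.
under eq_fun do rewrite big_ord_recr/=.
have mj : (m < N K.+1 - N K)%N by rewrite ltn_subRL.
apply: (clowerM_independent (F := fun x => \prod_(i < K) F i x) (NK K) mj) => //.
  by move=> x; exact: prodr_ge0.
rewrite subnKC//.
by rewrite (leq_trans (leq_addr m _))// ltnW.
Qed.

End independence.

(** * Realizing lower expectations by one probability *)

Lemma le_term_nneseries (R : realType) (u : (\bar R)^nat) (n : nat) :
  (forall k, 0 <= u k)%E -> (u n <= \sum_(0 <= k <oo) u k)%E.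
Proof.
move=> u0; have h : (\sum_(0 <= k < n.+1) u k <= \sum_(0 <= k <oo) u k)%E.
  by apply: nneseries_lim_ge => k _ _; exact: u0.
apply: le_trans h; rewrite big_nat_recr//= leeDr// sume_ge0// => k _.
Qed.

Section weak_compactness.
Context {R : realType} {d : measure_display} {Omega : measurableType d}.
Variables (H : set (Omega -> R)) (E : (Omega -> R) -> \bar R).
Hypotheses (rvH : rv_space H) (subE : sublinear_expectation H E).

Lemma measurable_rv Y : H Y -> measurable_fun [set: sigma_rv H] (Y : sigma_rv H -> R).
Proof.
move=> HY _ B mB; rewrite setTI; apply: sub_sigma_algebra.
by exists Y, B.
Qed.

Lemma prob_mean_le (P : probability (sigma_rv H) R) Y Z : H Y -> H Z ->
  (forall w, 0 <= Y w) -> (forall w, Y w <= Z w) ->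
  (prob_mean P Y <= prob_mean P Z)%E.
Proof.
move=> HY HZ Y0 YZ; apply: ge0_le_integral => //.
- by move=> w _; rewrite lee_fin.
- by apply/measurable_EFinP; exact: measurable_rv.
- by apply/measurable_EFinP; exact: measurable_rv.
- by move=> w _; rewrite lee_fin.
Qed.

(** For each K some P_K nearly attains the lower expectation of the first K
    terms. As the terms are nonnegative, P_K also controls every shorter sum, and
    the bound passes to a weak limit of the P_K. *)
Lemma realizing_probability (PP : set (probability (sigma_rv H) R))
    (Z : nat -> Omega -> R) (B : R) :
  countable_dim_weakly_compact PP ->
  (forall Y, bounded_part H Y -> E Y = ereal_sup [set prob_mean P Y | P in PP]) ->
  (forall k, bounded_part H (Z k)) -> (forall k w, 0 <= Z k w) ->
  (forall K, lower E (fun w => \sum_(k < K) Z k w) < B) ->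
  exists2 Q, PP Q &
    forall K, (prob_mean Q (fun w => (\sum_(k < K) Z k w)%R) <= B%:E)%E.
Proof.
move=> compPP EPP bZ Z0 ZB.
have bS K : bounded_part H (fun w => \sum_(k < K) Z k w).
  by apply: (bounded_sum rvH) => i _; exact: bZ.
have S0 K w : 0 <= \sum_(k < K) Z k w by exact: sumr_ge0.
have /choice[P PPP] : forall K, exists P, PP P /\
    (prob_mean P (fun w => \sum_(k < K) Z k w)%R < B%:E)%E.
  move=> K.
  have : ((- B)%:E < E (fun w => - \sum_(k < K) Z k w)%R)%E.
    by rewrite (mean_fin rvH subE (boundedN rvH (bS K))) lte_fin ltrNl; exact: ZB.
  rewrite (EPP _ (boundedN rvH (bS K))) => /ereal_sup_gt[_ [P PPP <-]] BP.
  exists P; split => //; move: BP; rewrite EFinN lteNl; apply: le_lt_trans.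
  rewrite leeNr /prob_mean -integral_ge0N//.
  by move=> w _; rewrite lee_fin.
have [nk [Q [nk_homo PPQ cvgQ]]] := compPP Z P bZ (fun K => (PPP K).1).
have nk_ge k : (k <= nk k)%N.
  by elim: k => // k ih; exact: leq_ltn_trans ih (nk_homo _ _ (ltnSn k)).
exists Q => // -[|e].
  have S_0 : (fun w => \sum_(k < 0) Z k w) = fun=> 0.
    by apply: funext => w; rewrite big_ord0.
  by apply: le_trans (ltW (PPP 0%N).2); rewrite S_0 /prob_mean !integral0.
have /choice[C ZC] : forall k, exists C, 0 <= C /\ forall w, `|Z k w| <= C.
  move=> k; have [_ [C ZC]] := bZ k.
  by exists `|C|; split=> // w; rewrite (le_trans (ZC w))// ler_norm.
pose F (x : nat -> R) := \sum_(j < e.+1) clip (C j) (x j).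
have cF : cyl 0 e.+1 F.
  apply: (cyl_sum (F := fun j x => clip (C j) (x j))) => j je; apply: cyl_widen (leq0n j) je _.
  by apply: cyl_coordinate; apply: bLip_clip; exact: (ZC j).1.
have FZ : (fun v : 'rV[R]_e.+1 => F (seq_of_row v)) \o
    random_vector (fun i : 'I_e.+1 => Z i) = (fun w => \sum_(k < e.+1) Z k w).
  apply: funext => w /=; apply: eq_bigr => i _.
  by rewrite (@seq_of_random_vector _ _ Z 0)// clip_id//; exact: (ZC i).2.
have := cvgQ e.+1 _ isT (C_bLip_cyl cF); rewrite FZ => /cvge_to_le; apply.
exists e.+1 => // k /= ek; apply: le_trans (ltW (PPP (nk k)).2).
apply: prob_mean_le; [by case: (bS e.+1)|by case: (bS (nk k))|exact: S0|move=> w].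
 rewrite -!(big_mkord xpredT (Z ^~ w)).
rewrite [leRHS](big_cat_nat (leq0n e.+1) (leq_trans ek (nk_ge k)))/= lerDl.
exact: sumr_ge0.
Qed.


(** Under the realizing probability Q, Borel-Cantelli gives Z_k < 1/2 eventually,
    almost surely. If A contained all these points, then for a countable cover of
    A the majorants of the indicators of its members, cut at 1, would sum to at
    least 1 almost surely, while their Q-means are bounded by capacities of total
    less than 1. Integrating the majorants instead of measuring A avoids any
    measurability question for A in sigma(H). *)
Lemma avoid_negligible_event (A : set Omega) (Z : nat -> Omega -> R) (B : R) :
  condition_CC H E -> (hatV_star H E A < 1)%E ->
  (forall k, bounded_part H (Z k)) -> (forall k w, 0 <= Z k w) ->
  (forall K, lower E (fun w => \sum_(k < K) Z k w) < B) ->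
  exists2 w, ~ A w & exists K, forall k, (K <= k)%N -> Z k w < 1 / 2.
Proof.
move=> [PP [compPP EPP]] /ereal_inf_lt[_ [D [mD AD] <-]] sumD bZ Z0 ZB.
have [Q PPQ QZ] := realizing_probability compPP EPP bZ Z0 ZB.
have E0 Y : H Y -> (forall w, 0 <= Y w) -> (0 <= E Y)%E.
  move=> HY Y0; rewrite -[leLHS](sublinear_cst subE 0).
  by apply: (sublinear_monotone subE) => //; exact: rv_cst.
have hatV0 n : (0 <= hatV H E (D n))%E.
  apply: le_ereal_inf_tmp => _ [xi [Hxi xiD] <-]; apply: E0 => // w.
  by apply: le_trans (xiD w); rewrite indicE.
have [e e0 sumDe] : exists2 e : R, 0 < e &
    (\sum_(0 <= n <oo) hatV H E (D n) + e%:E < 1)%E.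
  have : (0 <= \sum_(0 <= n <oo) hatV H E (D n))%E by exact: nneseries_ge0.
  move: sumD; case: (limn _) => // r; rewrite !lte_fin lee_fin => r1 r0.
  by exists ((1 - r) / 2); [lra|rewrite -EFinD lte_fin; lra].
have /choice[xi xiP] : forall n, exists xi, [/\ H xi, forall w, \1_(D n) w <= xi w &
    (E xi <= hatV H E (D n) + (e / (2 ^ n.+1)%:R)%:E)%E].
  move=> n; have en0 : 0 < e / (2 ^ n.+1)%:R by rewrite divr_gt0// ltr0n expn_gt0.
  have fin_hatV : hatV H E (D n) \is a fin_num.
    rewrite ge0_fin_numE//; apply: le_lt_trans (lt_trans sumD (ltry 1)).
    exact: le_term_nneseries.
  have [_ [xi [Hxi xiD] <-] xile] := lb_ereal_inf_adherent en0 fin_hatV.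
  by exists xi; split=> //; exact: ltW.
(* Cutting the majorants makes them bounded, hence within reach of (CC). *)
pose eta n w := Num.max 0 (Num.min (xi n w) 1).
have etaE n : bounded_part H (eta n).
  pose g (u : R) := Num.max 0 (Num.min u 1).
  apply: (@bounded_comp _ _ _ _ rvH g) => //; last by have [] := xiP n.
  split; last first.
    exists 1; split=> // u v; rewrite mul1r.
    exact: le_trans (dist_max_le _ _ _) (dist_min_le _ _ _).
  by exists 1 => u; rewrite /g; case_min_max; lra.
have eta0 n w : 0 <= eta n w by rewrite le_max lexx.
have meanQ n : (prob_mean Q (eta n) <= hatV H E (D n) + (e / (2 ^ n.+1)%:R)%:E)%E.
  have [Hxi xiD] := xiP n; apply: le_trans.
  apply: (@le_trans _ _ (E (eta n))).
    by rewrite (EPP _ (etaE n)); apply: ereal_sup_ubound; exists Q.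
  apply: (sublinear_monotone subE) => //; first by case: (etaE n).
  move=> w; have : 0 <= xi n w by apply: le_trans (xiD w); rewrite indicE.
  by rewrite /eta => ?; case_min_max; lra.
have meta n : measurable_fun [set: sigma_rv H] (fun w => (eta n w)%:E).
  by apply/measurable_EFinP; apply: measurable_rv; case: (etaE n).
have mZ n : measurable_fun [set: sigma_rv H] (Z n : sigma_rv H -> R).
  by apply: measurable_rv; case: (bZ n).
have mEZ n : measurable_fun [set: sigma_rv H] (fun w => (Z n w)%:E).
  exact/measurable_EFinP.
pose F k : set (sigma_rv H) := [set w | 1 / 2 <= Z k w].
have mF k : measurable (F k).
  have := mZ k measurableT _ (measurable_itv `[1 / 2, +oo[).
  by rewrite setTI set_itvE.
have QF0 : Q (lim_sup_set F) = 0.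
  apply: lim_sup_set_cvg0 => //.
  apply: (@le_lt_trans _ _ (\sum_(0 <= k <oo) (2%:E * prob_mean Q (Z k)))%E).
    apply: lee_nneseries => // k _.
    rewrite /prob_mean -ge0_integralZl//; last by move=> w _; rewrite lee_fin.
    rewrite -[leLHS](_ : \int[Q]_(w in setT) (\1_(F k) w)%:E = _)%E; last first.
      by rewrite integral_indic// setIT.
    apply: ge0_le_integral => //.
    - by apply/measurable_EFinP; exact: measurable_indic.
    - exact: measurable_funeM.
    - move=> w _; rewrite -EFinM lee_fin indicE; have := Z0 k w.
      by case: (boolP (w \in F k)) => [/set_mem|_]; rewrite /F/= => *; lra.
  rewrite nneseriesZl//; last first.
    by move=> k _; apply: integral_ge0 => w _; rewrite lee_fin.
  rewrite lte_mul_pinfty//; apply: le_lt_trans (ltry B).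
  apply: lime_le.
    apply: is_cvg_nneseries => k _ _; apply: integral_ge0 => w _.
    by rewrite lee_fin.
  exists 0%N => // K _ /=; apply: le_trans (QZ K); rewrite /prob_mean.
  under [leRHS]eq_integral do rewrite -sumEFin.
  rewrite ge0_integral_sum//; last by move=> k w _; rewrite lee_fin.
  by rewrite big_mkord.
apply: contrapT => nex.
suff : (1 <= \sum_(0 <= n <oo) prob_mean Q (eta n))%E.
  apply/negP; rewrite -ltNge; apply: le_lt_trans sumDe.
  apply: le_trans (epsilon_trick xpredT hatV0 (ltW e0)).
  apply: lee_nneseries => [k _ _|k _]; last exact: meanQ.
  by apply: integral_ge0 => w _; rewrite lee_fin.
rewrite /prob_mean -integral_nneseries//; last by move=> n w _; rewrite lee_fin.
rewrite -(probability_setT Q) -[X in (X <= _)%E]mul1e -integral_cst//.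
apply: ae_ge0_le_integral => //.
- by move=> w _; apply: nneseries_ge0 => n _ _; rewrite lee_fin.
- by apply: ge0_emeasurable_sum => // k w _ _; rewrite lee_fin.
exists (lim_sup_set F); split => //.
  apply: bigcap_measurable => // k _; exact: bigcup_measurable.
move=> w /= nw; apply: contrapT => nF; apply: nw => _.
have [K ZK] : exists K, forall k, (K <= k)%N -> Z k w < 1 / 2.
  apply: contrapT => nK; apply: nF => K _; apply: contrapT => nk; apply: nK.
  exists K => k Kk; rewrite ltNge; apply/negP => Zk; apply: nk.
  by exists k.
have : A w by apply: contrapT => nA; apply: nex; exists w => //; exists K.
move=> /AD[n _ Dnw].
apply: (@le_trans _ _ (eta n w)%:E).
  have [_ xiD _] := xiP n; have := xiD w; rewrite indicE mem_set//= => xi1.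
  by rewrite lee_fin /eta min_r// le_max lexx orbT.
apply: (le_term_nneseries (u := fun n => (eta n w)%:E)) => k.
by rewrite lee_fin.
Qed.

End weak_compactness.

(** * The normalization sqrt (2 n log log n) *)

Section iterated_logarithm.
Context {R : realType}.
Implicit Types (x y : R) (n : nat).

Lemma logM_ge1 x : 1 <= logM x.
Proof.
rewrite /logM -[leLHS](@expRK R) ler_ln ?posrE ?expR_gt0//.
  by rewrite le_max lexx.
by rewrite lt_max expR_gt0.
Qed.

Lemma le_logM x y : x <= y -> logM x <= logM y.
Proof.
move=> xy; rewrite /logM ler_ln ?posrE ?lt_max ?expR_gt0//.
by rewrite ge_max !le_max lexx xy orbT.
Qed.

Lemma ln_le_id x : 0 < x -> ln x <= x.
Proof.
move=> x0; have := expR_ge1Dx (ln x); rewrite lnK ?posrE// => h; lra.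
Qed.

Lemma logM_le_id x : 1 <= x -> logM x <= x.
Proof.
move=> x1; rewrite /logM; case: (leP (expR 1) x) => ex; last by rewrite expRK.
by apply: ln_le_id; lra.
Qed.

Lemma logM_le_sqrt x : 1 <= x -> logM x <= 2 * Num.sqrt x.
Proof.
move=> x1; have s1 : 1 <= Num.sqrt x by rewrite -[leLHS]sqrtr1 ler_wsqrtr.
rewrite /logM; case: (leP (expR 1) x) => ex; last by rewrite expRK; lra.
rewrite -[X in ln X](@sqr_sqrtr _ x); last by lra.
rewrite lnXn; last by lra.
by rewrite mulr_natl ler_wMn2r// ln_le_id; lra.
Qed.

Lemma logM_sqrt x : 0 <= x -> logM x / 2 <= logM (Num.sqrt x).
Proof.
move=> x0; have [ex|ex] := leP (expR 1) x; last first.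
  have -> : logM x = 1 by rewrite /logM max_l ?expRK ?ltW.
  by have := logM_ge1 (Num.sqrt x) => h; lra.
rewrite {1}/logM max_r// -[X in ln X](sqr_sqrtr x0) lnXn; last first.
  by rewrite sqrtr_gt0 (lt_le_trans (expR_gt0 1)).
rewrite -[X in X / _]mulr_natr mulfK//.
rewrite /logM ler_ln ?posrE ?lt_max ?expR_gt0//.
  by rewrite le_max lexx orbT.
by rewrite sqrtr_gt0 (lt_le_trans (expR_gt0 1)).
Qed.

Lemma logM_half x : 0 <= x -> logM x / 2 <= logM (x / 2).
Proof.
move=> x0; apply: le_trans (logM_sqrt x0) _.
have [x4|x4] := leP 4 x.
  apply: le_logM; rewrite -[leRHS]ger0_norm ?divr_ge0// -sqrtr_sqr.
  apply: ler_wsqrtr; nra.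
have e2 : 2 <= expR 1 :> R by have := expR_ge1Dx (1 : R); lra.
have s2 : Num.sqrt x <= 2.
  have -> : 2 = Num.sqrt (2 ^+ 2) :> R by rewrite sqrtr_sqr ger0_norm.
  by apply: ler_wsqrtr; lra.
apply: le_trans (logM_ge1 _); by rewrite /logM max_l ?expRK//; lra.
Qed.

(** Passing to a square root halves the logarithm, and thus at most halves the
    iterated logarithm, which never falls below 1. *)
Lemma loglogM_sqrt x : 0 <= x ->
  logM (logM x) / 2 <= logM (logM (Num.sqrt x)).
Proof.
move=> x0; have l0 : 0 <= logM x by have := logM_ge1 x; lra.
exact: le_trans (logM_half l0) (le_logM (logM_sqrt x0)).
Qed.

Definition lil n : R := Num.sqrt (2 * n%:R * logM (logM n%:R)).

Let LL_ge1 n : 1 <= logM (logM (n%:R : R)) := logM_ge1 _.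

Lemma lil_sqr n : lil n ^+ 2 = 2 * n%:R * logM (logM n%:R).
Proof.
have := LL_ge1 n; have : 0 <= n%:R :> R by [].
by rewrite /lil => ? ?; rewrite sqr_sqrtr//; nra.
Qed.

Lemma lil_ge0 n : 0 <= lil n. Proof. exact: sqrtr_ge0. Qed.

Lemma lil_gt0 n : (0 < n)%N -> 0 < lil n.
Proof.
move=> n0; have := LL_ge1 n; have : 0 < n%:R :> R by rewrite ltr0n.
by rewrite sqrtr_gt0 => ? ?; nra.
Qed.

Lemma le_lil n k : (n <= k)%N -> lil n <= lil k.
Proof.
move=> nk; have nk' : n%:R <= k%:R :> R by rewrite ler_nat.
apply: ler_wsqrtr; rewrite ler_pM ?ler_wpM2l ?mulr_ge0//.
  by have := LL_ge1 n; lra.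
exact/le_logM/le_logM.
Qed.

Lemma lil_le_mulr (e : R) n : 0 <= e -> (0 < n)%N ->
  4 <= e ^+ 2 * Num.sqrt n%:R -> lil n <= e * n%:R.
Proof.
move=> e0 n0 h; have n1 : 1 <= n%:R :> R by rewrite ler1n.
have s1 : 1 <= Num.sqrt n%:R :> R by rewrite -[leLHS]sqrtr1 ler_wsqrtr.
have l : logM (logM n%:R) <= 2 * Num.sqrt n%:R :> R.
  exact: le_trans (logM_le_id (logM_ge1 _)) (logM_le_sqrt n1).
rewrite -(@ler_pXn2r _ 2%N) ?nnegrE ?lil_ge0 ?mulr_ge0// lil_sqr.
have s2 : Num.sqrt n%:R * Num.sqrt n%:R = n%:R :> R by rewrite -expr2 sqr_sqrtr.
have h1 : 2 * n%:R * logM (logM n%:R) <= 2 * n%:R * (2 * Num.sqrt n%:R) :> R.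
  by rewrite ler_wpM2l// mulr_ge0.
apply: le_trans h1 _; rewrite exprMn [n%:R ^+ 2]expr2 -{3}s2.
move: s1 s2 h; set s := Num.sqrt _; set N := n%:R => s1 s2 h.
have : N * s * 4 <= N * s * (e ^+ 2 * s) by rewrite ler_wpM2l// mulr_ge0//; lra.
lra.
Qed.

Lemma lil_le n : lil n <= 2 * n%:R.
Proof.
case: n => [|n]; first by rewrite /lil !(mulr0, mul0r) sqrtr0.
apply: lil_le_mulr => //.
have : 1 <= Num.sqrt n.+1%:R :> R by rewrite -[leLHS]sqrtr1 ler_wsqrtr// ler1n.
by lra.
Qed.

Lemma lil_little_o (e : R) : 0 < e ->
  exists n0 : nat, forall n, (n0 <= n)%N -> lil n <= e * n%:R.
Proof.
move=> e0; exists (Num.truncn ((4 / e ^+ 2) ^+ 2)).+1 => n nn0.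
apply: lil_le_mulr; [exact: ltW|exact: leq_trans nn0|].
have e20 : 0 < e ^+ 2 by rewrite exprn_gt0.
have c0 : 0 <= 4 / e ^+ 2 by rewrite divr_ge0// ltW.
rewrite mulrC -ler_pdivrMr// -(ger0_norm c0) -sqrtr_sqr ler_wsqrtr//.
apply: le_trans (ltW (truncnS_gt _)) _.
by rewrite ler_nat.
Qed.

(** The hypothesis first gives |x| >= sqrt n, because log log >= 1; hence
    log log |x| >= (log log n) / 2, which is inserted back. *)
Lemma le_of_sqr_div_loglog (D x : R) n : 1 <= D -> (0 < n)%N ->
  4 * D ^+ 2 * n%:R <= x ^+ 2 / logM (logM `|x|) -> D * lil n <= `|x|.
Proof.
move=> D1 n0 h; have n1 : 1 <= n%:R :> R by rewrite ler1n.
have LL1 := logM_ge1 (logM `|x|).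
have {}h : 4 * D ^+ 2 * n%:R * logM (logM `|x|) <= x ^+ 2.
  by rewrite -ler_pdivlMr//; lra.
have D21 : 1 <= D ^+ 2 by rewrite exprn_ege1.
have sx : Num.sqrt n%:R <= `|x|.
  rewrite -sqrtr_sqr ler_wsqrtr//; apply: le_trans h.
  have : 1 * 1 <= D ^+ 2 * logM (logM `|x|) by rewrite ler_pM.
  set N := n%:R in n1 *; set P := D ^+ 2; set Q := logM _; nra.
have LLs : logM (logM n%:R) / 2 <= logM (logM `|x|).
  exact: le_trans (loglogM_sqrt (ler0n _ _)) (le_logM (le_logM sx)).
rewrite -(@ler_pXn2r _ 2%N) ?nnegrE ?mulr_ge0 ?lil_ge0//; last by lra.
rewrite exprMn lil_sqr real_normK ?num_real//; apply: le_trans h.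
have : 0 <= 4 * D ^+ 2 * n%:R by rewrite !mulr_ge0//; lra.
move=> /ler_wpM2l/(_ _ _ LLs); lra.
Qed.

End iterated_logarithm.

Section limsup_below.
Context {R : realType}.

Lemma eventually_lt_of_limn_esup (u : nat -> \bar R) (M : \bar R) :
  ~ (M <= limn_esup u)%E -> exists n0, forall n, (n0 <= n)%N -> (u n < M)%E.
Proof.
move=> /negP; rewrite -ltNge /limn_esup limf_esupE => /ereal_inf_lt.
move=> [_ [V [n0 _ n0V] <-]] VM; exists n0 => n nn0.
by apply: le_lt_trans VM; apply: ereal_sup_ubound; exists n => //; exact: n0V.
Qed.

End limsup_below.

(** * Stationarity and separated blocks of m-dependent sequences *)

Section m_dependent_sequences.
Context {R : realType} {d : measure_display} {Omega : measurableType d}.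
Variables (H : set (Omega -> R)) (E : (Omega -> R) -> \bar R).
Variables (m : nat) (X : nat -> Omega -> R).
Hypotheses (rvH : rv_space H) (subE : sublinear_expectation H E).
Hypotheses (HX : forall n, H (X n)).

Lemma m_dependentN : m_dependent E m X -> m_dependent E m (fun i w => - X i w).
Proof.
move=> mdepX n j n0 mj phi [[C phiC] [L phiL]].
pose psi (v : 'rV[R]_(n + (j - m))) := phi (- v).
have psi_bLip : C_bLip psi.
  split; first by exists C => v; exact: phiC.
  exists L => u v; rewrite (le_trans (phiL _ _))// -opprD.
  rewrite le_eqVlt; apply/orP; left; apply/eqP; congr (_ * Num.sqrt _).
  by apply: eq_bigr => i _; rewrite mxE sqrrN.
have rvN p k w : random_vector (fun i : 'I_p => fun w => - X (k + i)%N w) w =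
    - random_vector (fun i : 'I_p => X (k + i)%N) w.
  by apply/rowP => i; rewrite !mxE.
have phiE w w' : phi (row_mx (random_vector (fun i : 'I_n => fun w => - X i w) w)
    (random_vector (fun i : 'I_(j - m) => fun w => - X (n + m + i)%N w) w')) =
    psi (row_mx (random_vector (fun i : 'I_n => X i) w)
      (random_vector (fun i : 'I_(j - m) => X (n + m + i)%N) w')).
  by rewrite (rvN _ 0%N) rvN -opp_row_mx.
have := mdepX n j n0 mj psi psi_bLip.
under eq_fun do rewrite -phiE; move=> ->; congr (E _); apply: funext => w.
by congr (fine (E _)); apply: funext => w'; rewrite phiE.
Qed.

Lemma linear_stationaryN :
  linear_stationary E X -> linear_stationary E (fun i w => - X i w).
Proof.
move=> statX n p n0 p0 phi [[C phiC] [L phiL]].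
pose psi (v : 'rV[R]_1) := phi (- v).
have psi_bLip : C_bLip psi.
  split; first by exists C => v; exact: phiC.
  exists L => u v; rewrite (le_trans (phiL _ _))// -opprD.
  rewrite le_eqVlt; apply/orP; left; apply/eqP; congr (_ * Num.sqrt _).
  by apply: eq_bigr => i _; rewrite mxE sqrrN.
have phiE k : phi \o random_vector (fun (_ : 'I_1) w => \sum_(i < n) - X (i + k)%N w) =
    psi \o random_vector (fun (_ : 'I_1) w => \sum_(i < n) X (i + k)%N w).
  apply: funext => w /=; congr phi; apply/rowP => i; rewrite !mxE.
  by rewrite sumrN.
have phiE0 : phi \o random_vector (fun (_ : 'I_1) w => \sum_(i < n) - X i w) =
    psi \o random_vector (fun (_ : 'I_1) w => \sum_(i < n) X i w).
  apply: funext => w /=; congr phi; apply/rowP => i; rewrite !mxE.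
  by rewrite sumrN.
by rewrite phiE phiE0; exact: statX.
Qed.

Lemma partial_sumN n : partial_sum (fun i w => - X i w) n =
  (fun w => - partial_sum X n w).
Proof. by apply: funext => w; rewrite /partial_sum sumrN. Qed.

Lemma block_sum_path a n w :
  block_sum a (a + n) (path_of X w) = partial_sum X (a + n) w - partial_sum X a w.
Proof.
rewrite /block_sum /partial_sum -!(big_mkord xpredT (fun i => X i w)).
by rewrite [X in _ = X - _](big_cat_nat (leq0n a) (leq_addr n a))/= addrAC subrr add0r.
Qed.

(** The shift a = 0, which is excluded from linear stationarity, is the trivial
    case. *)
Lemma stationary_cmean (g : R -> R) a p : linear_stationary E X -> bLip g ->
  (0 < p)%N ->
  cmean E X (fun x => g (block_sum a (a + p) x)) =
  mean E (fun w => g (partial_sum X p w)).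
Proof.
move=> statX [[C gC] [L [L0 gL]]] p0.
have S0 q w : block_sum 0 q (path_of X w) = partial_sum X q w.
  by rewrite -[q in LHS]add0n block_sum_path /partial_sum big_ord0 subr0.
case: a => [|a].
  by rewrite add0n /cmean; under eq_fun do rewrite S0.
pose phi (v : 'rV[R]_1) := g (v ord0 ord0).
have phi_bLip : C_bLip phi.
  split; first by exists C => v; exact: gC.
  exists L => u v; rewrite (le_trans (gL _ _))// ler_wpM2l//.
  by rewrite (le_trans _ (le_euclid_norm _ ord0))// !mxE.
have -> : (fun w => g (partial_sum X p w)) =
    phi \o random_vector (fun (_ : 'I_1) w => \sum_(i < p) X i w).
  by apply: funext => w; rewrite /phi/= mxE.
rewrite /mean (statX p a.+1 p0 isT phi phi_bLip) /cmean /mean.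
congr (fine (E _)); apply: funext => w; rewrite /phi/= mxE; congr g.
rewrite /block_sum addnC -{1}[a.+1]add0n big_addn addnK big_mkord.
exact: eq_bigr.
Qed.

Lemma sum_pow_half (K : nat) : \sum_(k < K) (1 / 2 : R) ^+ k < 3.
Proof.
suff -> : \sum_(k < K) (1 / 2 : R) ^+ k = 2 - 2 * (1 / 2) ^+ K.
  by have : 0 <= (1 / 2 : R) ^+ K by []; move=> ?; lra.
elim: K => [|K ih]; first by rewrite big_ord0 expr0; lra.
by rewrite big_ord_recr/= ih exprS; lra.
Qed.

(** The bound 3 comes from the geometric series with ratio 1/2. *)
Lemma avoid_by_blocks (A : set Omega) (N : nat -> nat)
    (F : nat -> (nat -> R) -> R) :
  condition_CC H E -> m_dependent E m X -> (hatV_star H E A < 1)%E ->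
  (0 < N 0)%N -> (forall k, N k + m < N k.+1)%N ->
  (forall k, cyl (N k + m) (N k.+1) (F k)) -> (forall k x, 0 <= F k x) ->
  (forall k, clower E X (F k) <= (1 / 2) ^+ k) ->
  exists2 w, ~ A w &
    exists K, forall k, (K <= k)%N -> F k (path_of X w) < 1 / 2.
Proof.
move=> CC mdepX A1 N0 NS cF F0 Fle.
apply: (avoid_negligible_event rvH subE (B := 3) CC A1) => //.
- by move=> k; apply: (bounded_cyl rvH HX (cF k)).
- move=> K; have := clower_sum_blocks rvH subE HX mdepX K N0 NS cF.
  rewrite {1}/clower => ->; apply: le_lt_trans (sum_pow_half K).
  by apply: ler_sum => k _; exact: Fle.
Qed.

End m_dependent_sequences.

(** * The Borel-Cantelli argument for single variables *)

Section products.
Context {R : realType}.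

(** A quantitative form of: the product vanishes when the series diverges. *)
Lemma prod_one_minus_le (n : nat) (e : nat -> R) :
  (forall i, 0 <= e i <= 1) ->
  (\prod_(i < n) (1 - e i)) * (1 + \sum_(i < n) e i) <= 1.
Proof.
move=> e01; elim: n => [|n ih]; first by rewrite !big_ord0 addr0 mulr1.
rewrite !big_ord_recr/=; apply: le_trans ih.
have /andP[en0 en1] := e01 n.
have p0 : 0 <= \prod_(i < n) (1 - e i).
  by apply: prodr_ge0 => i _; have /andP[] := e01 i; lra.
have s0 : 0 <= \sum_(i < n) e i by apply: sumr_ge0 => i _; have /andP[] := e01 i.
rewrite -mulrA ler_wpM2l//; nra.
Qed.

End products.

Section tail_functions.
Context {R : realType}.
Implicit Types (b u : R).

(** A Lipschitz function between the indicators of |u| >= 2 b and |u| > b. *)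
Definition soft_tail b u : R := b^-1 * excess b b u.

Lemma bLip_soft_tail b : 0 < b -> bLip (soft_tail b).
Proof.
move=> b0; have := bLip_affine 0 b^-1 (bLip_excess b (ltW b0)).
by under eq_fun do rewrite add0r.
Qed.

Lemma soft_tail_ge0 b u : 0 < b -> 0 <= soft_tail b u.
Proof. by move=> b0; rewrite mulr_ge0 ?invr_ge0 ?excess_ge0// ltW. Qed.

Lemma soft_tail_le1 b u : 0 < b -> soft_tail b u <= 1.
Proof.
by move=> b0; rewrite /soft_tail mulrC ler_pdivrMr// mul1r excess_le.
Qed.

Lemma soft_tail_eq1 b u : 0 < b -> 2 * b <= `|u| -> soft_tail b u = 1.
Proof.
move=> b0 bu; rewrite /soft_tail /excess min_r ?mulVf ?gt_eqF//.
by rewrite le_max lerBrDr -mulr2n -mulr_natl bu.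
Qed.

Lemma soft_tail_eq0 b u : 0 < b -> `|u| <= b -> soft_tail b u = 0.
Proof.
move=> b0 bu; rewrite /soft_tail /excess max_r ?subr_le0//.
by rewrite min_l ?mulr0// ltW.
Qed.

End tail_functions.

Section borel_cantelli.
Context {R : realType} {d : measure_display} {Omega : measurableType d}.
Variables (H : set (Omega -> R)) (E : (Omega -> R) -> \bar R).
Variables (m : nat) (X : nat -> Omega -> R).
Hypotheses (rvH : rv_space H) (subE : sublinear_expectation H E).
Hypotheses (CC : condition_CC H E) (HX : forall n, H (X n)).
Hypotheses (mdepX : m_dependent E m X) (statX : linear_stationary E X).
Variables (A : set Omega) (D : R).
Hypotheses (A1 : (hatV_star H E A < 1)%E) (D1 : 1 <= D).
Hypothesis growth : forall w, ~ A w -> exists n0, forall n, (n0 <= n)%N ->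
  `|partial_sum X n w| <= D * lil n.

(** X_n is the difference of S_n and S_(n-1), so a path on which
    |S_n| <= D sqrt (2 n log log n) eventually has |X_n| bounded by this
    threshold along the indices n = (m + 1) (i + 1). *)
Definition threshold (i : nat) : R := 2 * D * lil (m.+1 * i.+1).

Let D_gt0 : 0 < D := lt_le_trans ltr01 D1.

Lemma threshold_gt0 i : 0 < threshold i.
Proof. by rewrite /threshold !mulr_gt0 ?lil_gt0 ?muln_gt0. Qed.

Lemma bounded_soft_tail i : bounded_part H (fun w => soft_tail (threshold i) (X 0 w)).
Proof.
by apply: (bounded_comp rvH (bLip_soft_tail (threshold_gt0 i)) (HX 0)).
Qed.

Definition tail_mean (i : nat) : R :=
  mean E (fun w => soft_tail (threshold i) (X 0 w)).

Lemma tail_mean_bounds i : 0 <= tail_mean i <= 1.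
Proof.
have bi := bounded_soft_tail i; apply/andP; split.
  apply: (mean_ge0 rvH subE bi) => w.
  exact: soft_tail_ge0 (threshold_gt0 i).
rewrite -[leRHS](mean_cst subE); apply: (mean_le rvH subE bi).
  exact: bounded_cst.
by move=> w; exact: soft_tail_le1 (threshold_gt0 i).
Qed.

Lemma clower_soft_tail i t :
  clower E X (fun x => 1 - soft_tail (threshold i) (block_sum t (t + 1) x)) =
  1 - tail_mean i.
Proof.
have bL := bLip_soft_tail (threshold_gt0 i).
rewrite /clower /lower.
have -> : (fun w => - (1 - soft_tail (threshold i) (block_sum t (t + 1) (path_of X w))))
    = (fun w => -1 + soft_tail (threshold i) (block_sum t (t + 1) (path_of X w))).
  by apply: funext => w; lra.
rewrite (mean_addc rvH subE); last first.
  exact: (bounded_cyl rvH HX (cyl_block_sum t (t + 1) bL)).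
rewrite opprD opprK; congr (1 - _).
have := stationary_cmean t statX bL (ltn0Sn 0); rewrite /cmean => ->.
rewrite /tail_mean; congr mean; apply: funext => w.
by rewrite /partial_sum big_ord1.
Qed.

(** If the series diverged, the products of 1 - f_i over long ranges of i would
    have arbitrarily small lower expectation. Successive ranges give functionals
    of separated blocks; where such a product is below 1/2, some factor is not 1,
    i.e. some |X_n| exceeds its threshold. *)
Lemma tail_mean_summable :
  exists B : R, forall I, \sum_(0 <= i < I) tail_mean i <= B.
Proof.
apply: contrapT => unb.
have e0 i : 0 <= tail_mean i by have /andP[] := tail_mean_bounds i.
have div (B : R) I0 : 0 < B ->
    exists I1, (I0 < I1)%N /\ B <= \sum_(I0 <= i < I1) tail_mean i.
  move=> B0; have [I1 I1B] : exists I1, B + \sum_(0 <= i < I0) tail_mean i <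
      \sum_(0 <= i < I1) tail_mean i.
    apply: contrapT => nI; apply: unb.
    exists (B + \sum_(0 <= i < I0) tail_mean i) => I.
    by rewrite leNgt; apply/negP => h; apply: nI; exists I.
  exists I1; have [I10|I01] := leqP I1 I0.
    move: I1B; rewrite (big_cat_nat (leq0n I1) I10)/= => I1B.
    have : 0 <= \sum_(I1 <= i < I0) tail_mean i by exact: sumr_ge0.
    by move=> ?; lra.
  split=> //; move: I1B; rewrite [ltRHS](big_cat_nat (leq0n I0) (ltnW I01))/=.
  by move=> ?; lra.
have small k I0 : exists I1, (I0 < I1)%N /\
    \prod_(j < I1 - I0) (1 - tail_mean (I0 + j)) <= (1 / 2) ^+ k.
  have k0 : 0 < (1 / 2 : R) ^+ k by rewrite exprn_gt0.
  have [|I1 [I01 I1B]] := div ((1 / 2) ^+ k)^-1 I0; first by rewrite invr_gt0.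
  exists I1; split => //.
  have := prod_one_minus_le (I1 - I0) (fun j => tail_mean_bounds (I0 + j)).
  have sumE : \sum_(i < I1 - I0) tail_mean (I0 + i) =
      \sum_(I0 <= i < I1) tail_mean i.
    rewrite -[X in _ = \sum_(X <= _ < _) _]add0n big_addn big_mkord.
    by apply: eq_bigr => j _; rewrite addnC.
  have : 0 <= \prod_(j < I1 - I0) (1 - tail_mean (I0 + j)).
    apply: prodr_ge0 => j _; have /andP[_] := tail_mean_bounds (I0 + j); lra.
  rewrite sumE; set p := \prod_(j < _) _; move: I1B; set s := \sum_(_ <= _ < _) _.
  move=> sB p0 ps; rewrite -[leRHS]mul1r -ler_pdivrMr//.
  by apply: le_trans ps; rewrite ler_wpM2l// (le_trans sB)// lerDr.
have /choice[nxt nxtP] : forall kI : nat * nat, exists I1, (kI.2 < I1)%N /\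
    \prod_(j < I1 - kI.2) (1 - tail_mean (kI.2 + j)) <= (1 / 2) ^+ kI.1.
  by move=> [k I0]; exact: small.
pose I := fix I k := if k is k'.+1 then nxt (k', I k') else 1%N.
have IS k : (I k < I k.+1)%N := (nxtP (k, I k)).1.
have I_ge k : (k < I k)%N by elim: k => // k ih; exact: leq_trans (IS k).
pose N k := (m.+1 * I k)%N.
(* The factor with index i reads the coordinate (m + 1) i + m (counted from 0), the
   first one that lies beyond a gap of length m after (m + 1) i coordinates. *)
pose F k (x : nat -> R) := \prod_(j < I k.+1 - I k)
  (1 - soft_tail (threshold (I k + j))
    (block_sum (m.+1 * (I k + j) + m) (m.+1 * (I k + j) + m + 1) x)).
have soft_tail01 i (u : R) : 0 <= 1 - soft_tail (threshold i) u <= 1.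
  have := soft_tail_ge0 u (threshold_gt0 i).
  by have := soft_tail_le1 u (threshold_gt0 i); move=> ? ?; apply/andP; split; lra.
have cG i : cyl (m.+1 * i + m) (m.+1 * i.+1) (fun x : nat -> R =>
    1 - soft_tail (threshold i) (block_sum (m.+1 * i + m) (m.+1 * i + m + 1) x)).
  have -> : (m.+1 * i.+1 = m.+1 * i + m + 1)%N by lia.
  apply: cylD; first exact: cyl_cst.
  exact/cylN/cyl_block_sum/bLip_soft_tail/threshold_gt0.
have [w nAw [K FK]] : exists2 w, ~ A w &
    exists K, forall k, (K <= k)%N -> F k (path_of X w) < 1 / 2.
  apply: (avoid_by_blocks rvH subE HX CC mdepX A1 (N := N)).
  - by rewrite /N muln_gt0.
  - by move=> k; rewrite /N; have := IS k; nia.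
  - move=> k; apply: (cyl_prod (F := fun j x => 1 - soft_tail (threshold (I k + j))
      (block_sum (m.+1 * (I k + j) + m) (m.+1 * (I k + j) + m + 1) x))) => j jI.
    by apply: cyl_widen (cG (I k + j)%N); rewrite /N; nia.
  - by move=> k x; apply: prodr_ge0 => j _; have /andP[] := soft_tail01 (I k + j)%N
      (block_sum (m.+1 * (I k + j) + m) (m.+1 * (I k + j) + m + 1) x).
  - move=> k; apply: le_trans (nxtP (k, I k)).2 => /=.
    rewrite (clower_prod_blocks rvH subE HX mdepX (N := fun j => (m.+1 * (I k + j))%N)
      (F := fun j x => 1 - soft_tail (threshold (I k + j))
      (block_sum (m.+1 * (I k + j) + m) (m.+1 * (I k + j) + m + 1) x))
      (I k.+1 - I k)).
    + by apply: ler_prod => j _; rewrite clower_soft_tail lexx andbT;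
        have /andP[_ ?] := tail_mean_bounds (I k + j); lra.
    + by have := I_ge k; nia.
    + by move=> j; nia.
    + by move=> j; rewrite addnS; exact: cG.
    + by move=> j x; have /andP[] := soft_tail01 (I k + j)%N
      (block_sum (m.+1 * (I k + j) + m) (m.+1 * (I k + j) + m + 1) x).
have [n0 nS] := growth nAw.
pose k := maxn K n0; have := FK k (leq_maxl _ _).
apply/negP; rewrite -leNgt /F big1 ?ler_pdivrMr//; first by lra.
move=> j _; set i := (I k + j)%N; set t := (m.+1 * i + m)%N.
rewrite soft_tail_eq0 ?subr0//; first exact: threshold_gt0.
have n0t : (n0 <= t)%N.
  rewrite (leq_trans (leq_maxr K n0))// -/k (leq_trans (ltnW (I_ge k)))//.
  by rewrite /t /i; nia.
rewrite block_sum_path (le_trans (ler_normB _ _))//.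
have tE : (t + 1 = m.+1 * i.+1)%N by rewrite /t; lia.
have := nS _ n0t; have := nS (t + 1)%N (leq_trans n0t (leq_addr _ _)).
rewrite /threshold -tE; have := le_lil (R := R) (leq_addr 1 t) => l h1 h2.
have : D * lil t <= D * lil (t + 1) by rewrite ler_wpM2l// ltW.
by lra.
Qed.

End borel_cantelli.

(** * Uniform tails and limits of truncated means *)

Section excess_sums.
Context {R : realType}.
Implicit Types (c K h u : R).

Lemma excess_le_right c K K' u : K <= K' -> excess c K u <= excess c K' u.
Proof.
by move=> KK; rewrite /excess le_min !ge_min lexx KK orbT.
Qed.

(** Layer-cake bound: each complete layer of height h below |u| contributes a
    term of the sum equal to 1. *)
Lemma excess_le_layers h (f : nat -> R -> R) i0 J u : 0 < h ->
  (forall i v, 0 <= f i v) -> (forall i v, h * i.+1%:R <= `|v| -> f i v = 1) ->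
  excess (h * i0.+1%:R) (h * J%:R) u <= h * \sum_(j < J) f (i0 + j)%N u.
Proof.
move=> h0 f0 f1; elim: J => [|J ih].
  by rewrite big_ord0 mulr0 excess_le.
rewrite big_ord_recr/= mulrDr; apply: le_trans (lerD ih (lexx _)).
have -> : h * J.+1%:R = h * J%:R + h by rewrite -natr1 mulrDr mulr1.
set c := h * _; have [hu|hu] := leP (h * (i0 + J).+1%:R) `|u|.
  rewrite f1// mulr1 /excess; set t := Num.max _ _; set s := h * _.
  by case_min_max; lra.
rewrite -[leLHS]addr0 lerD ?mulr_ge0 ?(ltW h0)//.
move: hu; rewrite -addSn natrD mulrDr -/c => hu.
have hJ : 0 <= h * J%:R by rewrite mulr_ge0// ltW.
rewrite /excess; move: hJ hu; set s := h * _; move: (`|u| : R) => a hJ hu.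
by case_min_max; lra.
Qed.

Lemma small_tail_sum (e : nat -> R) (B eps : R) : (forall i, 0 <= e i) ->
  (forall I, \sum_(0 <= i < I) e i <= B) -> 0 < eps ->
  exists i0, forall J, \sum_(j < J) e (i0 + j)%N <= eps.
Proof.
move=> e0 eB eps0; pose S := [set \sum_(0 <= i < I) e i | I in setT].
have supS : has_sup S.
  by split; [exists (\sum_(0 <= i < 0) e i), 0%N|exists B => _ [I _ <-]].
have [_ [i0 _ <-] i0S] := sup_adherent eps0 supS.
exists i0 => J; have : \sum_(0 <= i < i0 + J) e i <= sup S.
  by apply: ub_le_sup; [case: supS|exists (i0 + J)%N].
rewrite (big_cat_nat (leq0n i0) (leq_addr J i0))/=.
rewrite -[X in _ + \sum_(X <= _ < _) _]add0n [(i0 + J)%N]addnC big_addn addnK.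
rewrite [X in _ + X]big_mkord; under [X in _ + X]eq_bigr do rewrite addnC.
by lra.
Qed.

End excess_sums.

Section truncated_means.
Context {R : realType} {d : measure_display} {Omega : measurableType d}.
Variables (H : set (Omega -> R)) (E : (Omega -> R) -> \bar R).
Hypotheses (rvH : rv_space H) (subE : sublinear_expectation H E).
Implicit Types (S : Omega -> R) (mu : R).

(** Uniformity in the cut-off K replaces integrability of S: E is controlled on
    bounded variables only. *)
Definition uniform_tail S : Prop := forall eps : R, 0 < eps ->
  exists c0 : R, 0 <= c0 /\ forall c K, c0 <= c -> 0 <= K ->
    mean E (fun w => excess c K (S w)) <= eps.

Definition truncated_mean_limit S mu : Prop := forall eps : R, 0 < eps ->
  exists c0 : R, 0 <= c0 /\ forall c, c0 <= c ->
    `|mean E (fun w => clip c (S w)) - mu| <= eps.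

(** Two truncations at levels c <= c' differ by at most the excess over c cut at
    c', so that the truncated means form a Cauchy family. *)
Lemma truncated_mean_cvg S : H S -> uniform_tail S ->
  exists mu, truncated_mean_limit S mu /\
    (E (truncate c S) @[c --> +oo%R] --> mu%:E).
Proof.
move=> HS tailS; pose e c := mean E (truncate c S).
have bc c : 0 <= c -> bounded_part H (fun w => clip c (S w)).
  by move=> c0; exact: (bounded_comp rvH (bLip_clip c0) HS).
have e_cvg : cvg (e c @[c --> +oo%R]).
  apply/cauchy_cvgP; apply: cauchy_exP => eps eps0.
  have eps20 : 0 < eps / 2 by rewrite divr_gt0.
  have [c0 [c00 tailc]] := tailS _ eps20.
  exists (e c0); exists c0; split; first exact: num_real.
  move=> c /ltW c0c; have c0' := le_trans c00 c0c.
  rewrite -ball_normE/=; apply: (@le_lt_trans _ _ (eps / 2)); last by lra.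
  apply: le_trans (tailc c0 c (lexx _) c0').
  apply: (dist_mean_le rvH subE (bc _ c00) (bc _ c0')).
    exact: (bounded_comp rvH (bLip_excess c0 c0') HS).
  by move=> w; apply: clip_excess; rewrite c00.
exists (lim (e c @[c --> +oo%R])); split=> [eps eps0|].
  have : \forall c \near +oo%R, `|e c - lim (e c @[c --> +oo%R])| < eps.
    by move/cvgrPdistC_lt : e_cvg; apply.
  move=> [c0 [_ c0P]]; exists (`|c0| + 1); split; first by rewrite addr_ge0.
  move=> c c0c; apply/ltW/c0P; apply: lt_le_trans c0c.
  by rewrite (le_lt_trans (ler_norm _))// ltrDl.
apply/fine_cvgP; split; last exact: e_cvg.
exists 0; split=> // c /ltW c0; have -> := mean_fin rvH subE (bc c c0).
by [].
Qed.

End truncated_means.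

Section uniform_tails.
Context {R : realType} {d : measure_display} {Omega : measurableType d}.
Variables (H : set (Omega -> R)) (E : (Omega -> R) -> \bar R).
Variables (m : nat) (X : nat -> Omega -> R).
Hypotheses (rvH : rv_space H) (subE : sublinear_expectation H E).
Hypotheses (HX : forall n, H (X n)).

Lemma uniform_tailN S : uniform_tail E S -> uniform_tail E (fun w => - S w).
Proof.
move=> tailS eps /tailS[c0 [c00 c0P]]; exists c0; split=> // c K c0c K0.
apply: le_trans (c0P c K c0c K0).
by rewrite /excess; under eq_fun do rewrite normrN.
Qed.

Lemma rv_partial_sum p : H (partial_sum X p).
Proof.
elim: p => [|p ih].
  have -> : partial_sum X 0 = fun=> 0.
    by apply: funext => w; rewrite /partial_sum big_ord0.
  exact: rv_space_zero.
have -> : partial_sum X p.+1 = fun w => partial_sum X p w + X p w.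
  by apply: funext => w; rewrite /partial_sum big_ord_recr.
exact: rv_space_add.
Qed.

Lemma threshold_le (D : R) i : 1 <= D ->
  2 * threshold m D i <= 8 * D * m.+1%:R * i.+1%:R.
Proof.
move=> D1; rewrite /threshold; have := lil_le (R := R) (m.+1 * i.+1).
rewrite natrM => h; have : 4 * D * lil (m.+1 * i.+1) <=
    4 * D * (2 * (m.+1%:R * i.+1%:R)) by rewrite ler_wpM2l//; lra.
by lra.
Qed.

(** The thresholds grow at most linearly, so the layers of a fixed height h carry
    the terms of a tail of the convergent series. *)
Lemma uniform_tail_of_summable (D B : R) : 1 <= D ->
  (forall I, \sum_(0 <= i < I) tail_mean E m X D i <= B) ->
  uniform_tail E (X 0).
Proof.
move=> D1 sumB eps eps0; set h : R := 8 * D * m.+1%:R.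
have h0 : 0 < h by rewrite !mulr_gt0//; lra.
have t0 i : 0 < threshold m D i.
  by rewrite /threshold !mulr_gt0 ?lil_gt0 ?muln_gt0//; lra.
have bL i : bLip (soft_tail (threshold m D i)) := bLip_soft_tail (t0 i).
have bT i := bounded_comp rvH (bL i) (HX 0).
have e0 i : 0 <= tail_mean E m X D i.
  by apply: (mean_ge0 rvH subE (bT i)) => w; exact: soft_tail_ge0.
have [i0 i0P] := small_tail_sum e0 sumB (divr_gt0 eps0 h0).
exists (h * i0.+1%:R); split; first by rewrite mulr_ge0// ltW.
move=> c K cc K0; pose J := (Num.truncn (K / h)).+1.
have KJ : K <= h * J%:R by rewrite mulrC -ler_pdivrMr// ltW// truncnS_gt.
have J0 : 0 <= h * J%:R := le_trans K0 KJ.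
pose f i u := soft_tail (threshold m D i) u.
apply: (@le_trans _ _ (mean E (fun w => h * \sum_(j < J) f (i0 + j)%N (X 0 w)))).
  apply: (mean_le rvH subE).
  - exact: (bounded_comp rvH (bLip_excess c K0) (HX 0)).
  - apply: (boundedZ rvH).
    by apply: (bounded_sum rvH (Y := fun j w => f (i0 + j)%N (X 0 w))) => j _; exact: bT.
  - move=> w; apply: le_trans (excess_le_left _ _ cc) _.
    apply: le_trans (excess_le_right _ _ KJ) _.
    apply: excess_le_layers => // i v; first exact: soft_tail_ge0.
    by move=> hv; apply: soft_tail_eq1 => //; apply: le_trans (threshold_le i D1) hv.
have bS : bounded_part H (fun w => \sum_(j < J) f (i0 + j)%N (X 0 w)).
  by apply: (bounded_sum rvH (Y := fun j w => f (i0 + j)%N (X 0 w))) => j _; exact: bT.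
rewrite (meanZ rvH subE (ltW h0) bS).
rewrite mulrC -ler_pdivlMr//; apply: le_trans (i0P J).
by apply: (mean_sum rvH subE (Y := fun j w => f (i0 + j)%N (X 0 w))) => j _; exact: bT.
Qed.

Lemma stationary_mean1 (g : R -> R) i : linear_stationary E X -> bLip g ->
  mean E (fun w => g (X i w)) = mean E (fun w => g (X 0 w)).
Proof.
move=> statX bg; have := stationary_cmean i statX bg (ltn0Sn 0).
have -> : (fun w => g (partial_sum X 1 w)) = (fun w => g (X 0 w)).
  by apply: funext => w; rewrite /partial_sum big_ord1.
move=> <-; congr mean; apply: funext => w.
by rewrite /block_sum addn1 big_nat1.
Qed.

(** The excess of a sum of p terms over p c is at most the sum of the excesses
    over c. *)
Lemma uniform_tail_partial_sum p : linear_stationary E X -> (0 < p)%N ->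
  uniform_tail E (X 0) -> uniform_tail E (partial_sum X p).
Proof.
move=> statX p0 tailX eps eps0; have pR : 0 < p%:R :> R by rewrite ltr0n.
have [c0 [c00 c0P]] := tailX _ (divr_gt0 eps0 pR).
exists (p%:R * c0); split; first by rewrite mulr_ge0.
move=> c K cc K0; have bE i := bounded_comp rvH (bLip_excess c0 K0) (HX i).
apply: (@le_trans _ _ (mean E (fun w => \sum_(i < p) excess c0 K (X i w)))).
  apply: (mean_le rvH subE).
  - exact: (bounded_comp rvH (bLip_excess c K0) (rv_partial_sum p)).
  - by apply: (bounded_sum rvH (Y := fun i w => excess c0 K (X i w))) => i _; exact: bE.
  - move=> w; apply: le_trans (excess_le_left _ _ cc) _.
    exact: (excess_sum p (fun i => X i w) K0 c00).
apply: le_trans (mean_sum rvH subE (Y := fun i w => excess c0 K (X i w)) _) _.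
  by move=> i _; exact: bE.
rewrite (eq_bigr (fun=> mean E (fun w => excess c0 K (X 0 w)))); last first.
  by move=> i _; apply: stationary_mean1 => //; exact: bLip_excess.
rewrite sumr_const card_ord -mulr_natr -ler_pdivlMr//.
exact: c0P.
Qed.

Lemma truncated_mean_limit_add_ge0 (S : Omega -> R) (mu nu : R) : H S ->
  truncated_mean_limit E S mu -> truncated_mean_limit E (fun w => - S w) nu ->
  0 <= mu + nu.
Proof.
move=> HS muP nuP; apply/ler_addgt0Pr => eps eps0.
have eps2 : 0 < eps / 2 by rewrite divr_gt0.
have [c [c0 cP]] := muP _ eps2; have [c' [c'0 c'P]] := nuP _ eps2.
pose C := Num.max c c'; have C0 : 0 <= C by rewrite le_max c0.
have := mean_add_meanN_ge0 rvH subE (bounded_comp rvH (bLip_clip C0) HS).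
have := c'P C; rewrite le_max lexx orbT; under eq_fun do rewrite clipN//.
have := cP C; rewrite le_max lexx => /(_ isT) + /(_ isT).
by rewrite !ler_norml => /andP[? ?] /andP[? ?] ?; lra.
Qed.

End uniform_tails.

(** * Blocks with a drift *)

Section block_functional.
Context {R : realType}.
Implicit Types (x : nat -> R) (a c K lam y : R).

(** From e^t >= 1 + t with t = y + 2 y^2, since
    (1 - y) (1 + y + 2 y^2) = 1 + y^2 (1 - 2 y). *)
Lemma one_minus_mul_expR_ge1 y : y <= 1 / 2 ->
  1 <= (1 - y) * expR (y + 2 * y ^+ 2).
Proof.
move=> y2; have h := expR_ge1Dx (y + 2 * y ^+ 2).
have : (1 - y) * (1 + (y + 2 * y ^+ 2)) <= (1 - y) * expR (y + 2 * y ^+ 2).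
  by rewrite ler_wpM2l//; lra.
apply: le_trans; rewrite expr2; nra.
Qed.

(** The logarithm of 1 - y is at least - y - 2 y^2 for y <= 1/2. *)
Lemma prod_one_minus_lt1 (q : nat) (y : nat -> R) :
  (forall j, y j <= 1 / 2) -> \prod_(j < q) (1 - y j) < 1 ->
  0 < \sum_(j < q) (y j + 2 * y j ^+ 2).
Proof.
move=> y2 p1; have p0 : 0 <= \prod_(j < q) (1 - y j).
  by apply: prodr_ge0 => j _; have := y2 j; lra.
have : 1 <= (\prod_(j < q) (1 - y j)) * expR (\sum_(j < q) (y j + 2 * y j ^+ 2)).
  elim: (q) => [|k ih]; first by rewrite !big_ord0 expR0 mulr1.
  rewrite !big_ord_recr/= expRD mulrACA -[leLHS]mulr1 ler_pM//.
  exact: one_minus_mul_expR_ge1.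
move=> h; rewrite -expR_gt1; rewrite ltNge; apply/negP => e1.
have : (\prod_(j < q) (1 - y j)) * expR (\sum_(j < q) (y j + 2 * y j ^+ 2)) <=
    \prod_(j < q) (1 - y j) by rewrite ler_piMr.
by move=> ?; lra.
Qed.

Variables (s p m q : nat).

Definition long_sum (j : nat) x : R :=
  block_sum (s + j * (p + m)) (s + j * (p + m) + p) x.

Definition gap_term (j t : nat) x : R := x (s + j * (p + m) + p + t)%N.

Lemma block_sum_decomposition x :
  block_sum s (s + q * (p + m)) x =
  \sum_(j < q) (long_sum j x + \sum_(t < m) gap_term j t x).
Proof.
elim: q => [|k ih].
  by rewrite big_ord0 mul0n addn0 /block_sum big_geq.
rewrite big_ord_recr/= -ih /block_sum mulSnr.
rewrite (big_cat_nat (n := s + k * (p + m)))/=; [|by lia|by lia].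
congr (_ + _).
rewrite (big_cat_nat (n := s + k * (p + m) + p))/=; [|by lia|by lia].
congr (_ + _).
have -> : (s + (k * (p + m) + (p + m)) = m + (s + k * (p + m) + p))%N by lia.
rewrite -{1}[(s + k * (p + m) + p)%N]add0n big_addn addnK big_mkord.
by apply: eq_bigr => t _; rewrite /gap_term addnC.
Qed.

Definition long_factor lam a c (j : nat) x : R :=
  1 - lam * (clip c (long_sum j x) - a).

Definition block_error c K x : R := \sum_(j < q)
  (excess c K (long_sum j x) + \sum_(t < m) excess 0 K (gap_term j t x)).

(** The product detects whether the truncated long sums have a positive drift;
    the second term penalizes the truncation errors and the terms in the gaps. *)
Definition block_functional lam a c K x : R :=
  \prod_(j < q) long_factor lam a c j x + K^-1 * block_error c K x.

Lemma dist_clip_le a c u : 0 <= c -> 0 <= a -> `|clip c u - a| <= c + a.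
Proof.
by move=> c0 a0; rewrite (le_trans (ler_normB _ _))// lerD ?norm_clip// ger0_norm.
Qed.

Lemma cyl_long_factor lam a c j : 0 <= c ->
  cyl (s + j * (p + m)) (s + j * (p + m) + p) (long_factor lam a c j).
Proof.
move=> c0; rewrite (_ : long_factor _ _ _ _ =
    fun x => 1 + lam * a + (- lam) * clip c (long_sum j x)).
  exact/(cyl_block_sum _ _ (g := fun u => 1 + lam * a + - lam * clip c u))
    /bLip_affine/bLip_clip.
by apply: funext => x; rewrite /long_factor; ring.
Qed.

Lemma long_factor_ge0 lam a c j x : 0 < lam -> 0 <= a -> 0 <= c ->
  lam * (c + a) <= 1 / 2 -> 0 <= long_factor lam a c j x.
Proof.
move=> lam0 a0 c0 lamG; rewrite /long_factor subr_ge0.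
have h := dist_clip_le (long_sum j x) c0 a0.
have : lam * (clip c (long_sum j x) - a) <= lam * (c + a).
  by rewrite ler_wpM2l ?(ltW lam0)// (le_trans (ler_norm _)).
by move=> ?; lra.
Qed.

Lemma cyl_long_excess c K j : 0 < K ->
  cyl (s + j * (p + m)) (s + j * (p + m) + p) (fun x => excess c K (long_sum j x)).
Proof. by move=> K0; exact/cyl_block_sum/bLip_excess/ltW. Qed.

Lemma cyl_gap_excess K j t : 0 < K ->
  cyl (s + j * (p + m) + p + t) (s + j * (p + m) + p + t).+1
    (fun x => excess 0 K (gap_term j t x)).
Proof. by move=> K0; exact/cyl_coordinate/bLip_excess/ltW. Qed.

Lemma cyl_prod_long_factor lam a c : 0 <= c ->
  cyl s (s + q * (p + m)) (fun x => \prod_(j < q) long_factor lam a c j x).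
Proof.
move=> c0; apply: (cyl_prod (F := fun j x => long_factor lam a c j x)) => j jq.
have jq' : (j.+1 * (p + m) <= q * (p + m))%N by rewrite leq_mul2r jq orbT.
by apply: cyl_widen (cyl_long_factor lam a j c0); lia.
Qed.

Lemma cyl_block_error c K : 0 < K ->
  cyl s (s + q * (p + m)) (block_error c K).
Proof.
move=> K0; apply: (cyl_sum (F := fun j x => excess c K (long_sum j x) +
  \sum_(t < m) excess 0 K (gap_term j t x))) => j jq.
have jq' : (j * (p + m) + (p + m) <= q * (p + m))%N by rewrite -mulSnr leq_mul2r jq orbT.
apply: cylD; first by apply: cyl_widen (cyl_long_excess c j K0); lia.
apply: (cyl_sum (F := fun t x => excess 0 K (gap_term j t x))) => t tm.
by apply: cyl_widen (cyl_gap_excess j t K0); lia.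
Qed.

Lemma cyl_block_functional lam a c K : 0 <= c -> 0 < K ->
  cyl s (s + q * (p + m)) (block_functional lam a c K).
Proof.
move=> c0 K0; apply: cylD; first exact: cyl_prod_long_factor.
by apply: cylM; [exact: cyl_cst|exact: cyl_block_error].
Qed.

Lemma block_functional_ge0 lam a c K x : 0 < lam -> 0 <= a -> 0 <= c ->
  0 < K -> lam * (c + a) <= 1 / 2 -> 0 <= block_functional lam a c K x.
Proof.
move=> lam0 a0 c0 K0 lamG; rewrite addr_ge0 ?prodr_ge0//.
  by move=> j _; exact: long_factor_ge0.
rewrite mulr_ge0 ?invr_ge0 ?(ltW K0)//; apply: sumr_ge0 => j _.
rewrite addr_ge0 ?sumr_ge0 ?excess_ge0 ?(ltW K0)// => t _.
by rewrite excess_ge0 ?ltW.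
Qed.

(** A value below 1/2 makes the product less than 1, which bounds the sum of the
    truncated long sums from below, and makes the total error at most K / 2; in
    particular no excess reaches its cut-off K, so the errors are the actual
    differences between the block sum and the truncated sums. *)
Lemma block_sum_ge_of_functional lam a c K x :
  0 < lam -> 0 <= a -> 0 <= c -> 0 < K -> lam * (c + a) <= 1 / 2 ->
  block_functional lam a c K x < 1 / 2 ->
  q%:R * (a - 2 * lam * (c + a) ^+ 2) - K / 2 <=
    block_sum s (s + q * (p + m)) x.
Proof.
move=> lam0 a0 c0 K0 lamG Fx.
pose y j := lam * (clip c (long_sum j x) - a).
have ynorm j : `|y j| <= lam * (c + a).
  by rewrite normrM (gtr0_norm lam0) ler_wpM2l ?(ltW lam0)// dist_clip_le.
have y2 j : y j <= 1 / 2 by rewrite (le_trans (ler_norm _))// (le_trans (ynorm j)).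
have prod0 : 0 <= \prod_(j < q) (1 - y j).
  by apply: prodr_ge0 => j _; have := y2 j; lra.
have ex0 c' u : 0 <= excess c' K u by apply: excess_ge0; exact: ltW.
have term0 j : 0 <= excess c K (long_sum j x) + \sum_(t < m) excess 0 K (gap_term j t x).
  by rewrite addr_ge0// sumr_ge0.
have err0 : 0 <= block_error c K x by apply: sumr_ge0 => j _; exact: term0.
have [prod1 errK] : \prod_(j < q) (1 - y j) < 1 /\ block_error c K x < K / 2.
  move: Fx; rewrite /block_functional.
  have : 0 <= K^-1 * block_error c K x by rewrite mulr_ge0// invr_ge0 ltW.
  have prodE : \prod_(j < q) long_factor lam a c j x = \prod_(j < q) (1 - y j) by [].
  rewrite prodE => h0 h; split; first by lra.
  have : K^-1 * block_error c K x < 1 / 2 by lra.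
  by rewrite mulrC ltr_pdivrMr//; lra.
have := prod_one_minus_lt1 y2 prod1 => sumy.
have lamsum : 0 < lam * (\sum_(j < q) (clip c (long_sum j x) - (a - 2 * lam * (c + a) ^+ 2))).
  apply: lt_le_trans sumy _; rewrite mulr_sumr; apply: ler_sum => j _.
  rewrite /y mulrBr; have := ynorm j; rewrite /y => yn.
  have : (lam * (clip c (long_sum j x) - a)) ^+ 2 <= (lam * (c + a)) ^+ 2.
    rewrite -[leLHS]real_normK ?num_real// ler_pXn2r ?nnegrE//.
    by rewrite mulr_ge0 ?(ltW lam0)// addr_ge0.
  rewrite (exprMn _ lam (c + a)) expr2 -/(lam * lam); lra.
move: lamsum; rewrite pmulr_rgt0// sumrB sumr_const card_ord -mulr_natl => sumW.
rewrite block_sum_decomposition.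
apply: (@le_trans _ _ (\sum_(j < q) clip c (long_sum j x) - block_error c K x)); first lra.
rewrite /block_error -sumrB; apply: ler_sum => j _.
have termK : excess c K (long_sum j x) + \sum_(t < m) excess 0 K (gap_term j t x) < K.
  apply: (@le_lt_trans _ _ (block_error c K x)); last by lra.
  by rewrite /block_error (bigD1 j)//= lerDl sumr_ge0.
have longK : excess c K (long_sum j x) < K.
  by apply: le_lt_trans termK; rewrite lerDl sumr_ge0.
have := norm_sub_clip c0 longK => long_dist.
have long_ge : clip c (long_sum j x) - excess c K (long_sum j x) <= long_sum j x.
  have := ler_norm (clip c (long_sum j x) - long_sum j x).
  by rewrite distrC long_dist; lra.
have gap_ge : - \sum_(t < m) excess 0 K (gap_term j t x) <= \sum_(t < m) gap_term j t x.
  rewrite -sumrN; apply: ler_sum => t _.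
  have gapK : excess 0 K (gap_term j t x) < K.
    apply: le_lt_trans termK; rewrite (bigD1 t)//= addrCA lerDl.
    by rewrite addr_ge0// sumr_ge0.
  have := norm_sub_clip (lexx 0) gapK.
  have -> : clip 0 (gap_term j t x) = 0 :> R.
    apply/eqP; rewrite -normr_le0; exact: norm_clip.
  by rewrite subr0 => <-; rewrite lerNl -normrN ler_norm.
lra.
Qed.

End block_functional.

Section frequent_drift.
Context {R : realType} {d : measure_display} {Omega : measurableType d}.
Variables (H : set (Omega -> R)) (E : (Omega -> R) -> \bar R).
Variables (m : nat) (X : nat -> Omega -> R).
Hypotheses (rvH : rv_space H) (subE : sublinear_expectation H E).
Hypotheses (HX : forall n, H (X n)).
Hypotheses (mdepX : m_dependent E m X) (statX : linear_stationary E X).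
Hypothesis tailX : uniform_tail E (X 0).

Lemma excess0_le (c K u : R) : 0 <= c -> 0 <= K ->
  excess 0 K u <= c + excess c K u.
Proof.
move=> c0 K0; rewrite /excess subr0; move: (`|u| : R) => v.
by case_min_max; lra.
Qed.

Lemma mean_abs_bounded : exists B : R, 0 <= B /\ forall K i, 0 <= K ->
  mean E (fun w => excess 0 K (X i w)) <= B.
Proof.
have [c [c0 cP]] := tailX ltr01; exists (c + 1); split=> [|K i K0].
  exact: addr_ge0.
rewrite (stationary_mean1 i statX (bLip_excess 0 K0)).
have bE := bounded_comp rvH (bLip_excess c K0) (HX 0).
apply: (@le_trans _ _ (mean E (fun w => c + excess c K (X 0 w)))).
  apply: (mean_le rvH subE).
  - exact: (bounded_comp rvH (bLip_excess 0 K0) (HX 0)).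
  - exact: (boundedD rvH (bounded_cst rvH c) bE).
  - by move=> w; exact: excess0_le.
by rewrite (mean_addc rvH subE c bE) lerD2l cP.
Qed.

Section one_block.
Variables (n p q : nat) (lam a c K : R).
Hypotheses (n0 : (0 < n)%N) (p0 : (0 < p)%N).
Hypotheses (lam0 : 0 < lam) (a0 : 0 <= a) (c0 : 0 <= c) (K0 : 0 < K).
Hypothesis lamG : lam * (c + a) <= 1 / 2.

Lemma clower_long_factor j :
  clower E X (long_factor (n + m) p m lam a c j) =
  1 - lam * (mean E (fun w => clip c (partial_sum X p w)) - a).
Proof.
have cL := cyl_block_sum (n + m + j * (p + m)) (n + m + j * (p + m) + p) (bLip_clip c0).
have bL := bounded_cyl rvH HX cL.
rewrite /clower /lower.
have -> : (fun w => - long_factor (n + m) p m lam a c j (path_of X w)) =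
    (fun w => - (1 + lam * a) + lam * clip c (block_sum (n + m + j * (p + m))
      (n + m + j * (p + m) + p) (path_of X w))).
  by apply: funext => w; rewrite /long_factor /long_sum; lra.
rewrite (mean_addc rvH subE _ (boundedZ rvH lam bL)) (meanZ rvH subE (ltW lam0) bL).
have := stationary_cmean (n + m + j * (p + m)) statX (bLip_clip c0) p0.
by rewrite /cmean => ->; ring.
Qed.

Lemma clower_prod_long_factor :
  clower E X (fun x => \prod_(j < q) long_factor (n + m) p m lam a c j x) =
  \prod_(j < q) (1 - lam * (mean E (fun w => clip c (partial_sum X p w)) - a)).
Proof.
rewrite (clower_prod_blocks rvH subE HX mdepX (N := fun j => (n + j * (p + m))%N)).
- by apply: eq_bigr => j _; exact: clower_long_factor.
- by rewrite mul0n addn0.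
- by move=> j; rewrite mulSnr; have := p0; lia.
- by move=> j; apply: cyl_widen (cyl_long_factor _ _ _ _ _ _ c0); lia.
- by move=> j x; exact: long_factor_ge0.
Qed.

Lemma mean_block_error_le (e B : R) :
  mean E (fun w => excess c K (partial_sum X p w)) <= e ->
  (forall i, mean E (fun w => excess 0 K (X i w)) <= B) ->
  cmean E X (block_error (n + m) p m q c K) <= q%:R * (e + m%:R * B).
Proof.
move=> le_e le_B.
have bl j := bounded_cyl rvH HX (cyl_long_excess (n + m) p m c j K0).
have bg j t := bounded_cyl rvH HX (cyl_gap_excess (n + m) p m j t K0).
have bgs j := bounded_sum rvH (n := m) (fun t _ => bg j t).
have bb j := boundedD rvH (bl j) (bgs j).
apply: le_trans (mean_sum rvH subE (fun j _ => bb j)) _.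
rewrite mulr_natl -[X in _ *+ X]card_ord -sumr_const; apply: ler_sum => j _.
apply: le_trans (meanD rvH subE (bl j) (bgs j)) _; apply: lerD.
  have := stationary_cmean (n + m + j * (p + m)) statX (bLip_excess c (ltW K0)) p0.
  by rewrite /cmean => ->.
apply: le_trans (mean_sum rvH subE (fun t _ => bg j t)) _.
rewrite mulr_natl -[X in _ *+ X]card_ord -sumr_const; apply: ler_sum => t _.
exact: le_B.
Qed.

Lemma clower_block_functional_le :
  clower E X (block_functional (n + m) p m q lam a c K) <=
  \prod_(j < q) (1 - lam * (mean E (fun w => clip c (partial_sum X p w)) - a)) +
  K^-1 * cmean E X (block_error (n + m) p m q c K).
Proof.
have be := bounded_cyl rvH HX (cyl_block_error (n + m) p m q c K0).
have bP := bounded_cyl rvH HX (cyl_prod_long_factor (n + m) p m q lam a c0).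
rewrite -clower_prod_long_factor /cmean -(meanZ rvH subE _ be) ?invr_ge0 ?(ltW K0)//.
exact: (lowerD_le rvH subE bP (boundedZ rvH _ be)).
Qed.

End one_block.

(** The parameters are chosen in the order p, c, lam, q: p large makes the share
    of the gaps small, c large makes the truncation errors of the sums of length
    p small, lam small makes the quadratic term of [block_sum_ge_of_functional]
    at most half of the drift a = delta p / 4, and q large makes the product, of
    lower expectation at most (1 - lam a)^q, small. *)
Lemma exists_drifting_block (delta : R) : 0 < delta ->
  (forall p1, exists2 p, (p1 <= p)%N & exists2 mu,
     truncated_mean_limit E (partial_sum X p) mu & delta * p%:R < mu) ->
  forall (eps : R) (n L0 : nat), 0 < eps -> (0 < n)%N ->
  exists (L : nat) (F : (nat -> R) -> R),
    [/\ (L0 < L)%N, cyl (n + m) (n + m + L) F, forall x, 0 <= F x,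
        clower E X F <= eps &
        forall x, F x < 1 / 2 ->
          delta * L%:R / 32 <= block_sum (n + m) (n + m + L) x].
Proof.
move=> delta0 freq eps n L0 eps0 n0.
have [B [B0 BP]] := mean_abs_bounded.
(* With K = L / kap the total error K / 2 is delta L / 32, half of the guaranteed
   drift q delta p / 8 >= delta L / 16 of the truncated sums. *)
pose kap : R := 16 / delta; have kap0 : 0 < kap by rewrite divr_gt0.
have [p p1p [mu muP mu_gt]] :=
  freq (maxn m.+1 (Num.truncn (4 * kap * m%:R * B / eps)).+1).
have [mp p1] : (m < p)%N /\ 4 * kap * m%:R * B / eps <= p%:R.
  move: p1p; rewrite geq_max => /andP[-> h]; split=> //.
  by apply: le_trans (ltW (truncnS_gt _)) _; rewrite ler_nat.
have p0 : (0 < p)%N := leq_ltn_trans (leq0n m) mp.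
have pR : 1 <= p%:R :> R by rewrite ler1n.
have mpR : m%:R <= p%:R :> R by rewrite ler_nat ltnW.
have mR0 : 0 <= m%:R :> R by [].
have {}p1 : 4 * (kap * (m%:R * B)) <= eps * p%:R.
  by move: p1; rewrite ler_pdivrMr// => h; lra.
have e10 : 0 < eps / (4 * kap) by rewrite divr_gt0// mulr_gt0.
have [cT [cT0 cTP]] := uniform_tail_partial_sum rvH subE HX statX p0 tailX e10.
have dp0 : 0 < delta * p%:R by rewrite mulr_gt0//; lra.
have [cM [cM0 cMP]] := muP (delta * p%:R / 2) ltac:(by rewrite divr_gt0).
pose c := Num.max cT cM; have c0 : 0 <= c by rewrite le_max cT0.
have mean_clip : delta * p%:R / 2 <= mean E (fun w => clip c (partial_sum X p w)).
  have := cMP c; rewrite le_max lexx orbT => /(_ isT).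
  by rewrite ler_norml => /andP[? ?]; lra.
pose a : R := delta * p%:R / 4; have a0 : 0 < a by rewrite divr_gt0.
pose G := c + a; have G0 : 0 < G by rewrite ltr_wpDl.
(* This makes 2 lam G^2 = a / 2. *)
pose lam := a / (4 * G ^+ 2).
have G20 : 0 < G ^+ 2 by rewrite exprn_gt0.
have lam0 : 0 < lam by rewrite divr_gt0// mulr_gt0.
have lamG2 : lam * G ^+ 2 = a / 4.
  by rewrite /lam; field; rewrite gt_eqF.
have lamG : lam * G <= 1 / 4.
  have : lam * G * G <= 1 / 4 * G.
    by rewrite -mulrA -expr2 lamG2 /G; lra.
  by rewrite ler_pM2r.
have mean_clip_le : mean E (fun w => clip c (partial_sum X p w)) <= c.
  rewrite -[leRHS](mean_cst subE); apply: (mean_le rvH subE).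
  - exact: (bounded_comp rvH (bLip_clip c0) (rv_partial_sum rvH HX p)).
  - exact: bounded_cst.
  - by move=> w; rewrite (le_trans (ler_norm _))// norm_clip.
pose x0 := lam * a; have x00 : 0 < x0 by rewrite mulr_gt0.
have x01 : x0 <= 1.
  have : lam * a <= lam * G by rewrite ler_wpM2l ?(ltW lam0)// /G; lra.
  by rewrite /x0; lra.
pose q := maxn L0.+1 (Num.truncn (2 / eps / x0)).+1.
have qL0 : (L0 < q)%N by rewrite leq_max leqnn.
have qR : 2 / eps <= q%:R * x0.
  rewrite -ler_pdivrMr//; apply: le_trans (ltW (truncnS_gt _)) _.
  by rewrite ler_nat leq_max leqnn orbT.
have q0 : 0 < q%:R :> R by rewrite ltr0n (leq_ltn_trans _ qL0).
pose L := (q * (p + m))%N; have LR : L%:R = q%:R * (p%:R + m%:R) :> R.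
  by rewrite natrM natrD.
have L_gt0 : 0 < L%:R :> R by rewrite LR mulr_gt0//; lra.
pose K : R := L%:R / kap; have K0 : 0 < K by rewrite divr_gt0.
have lamG' : lam * (c + a) <= 1 / 2 by rewrite -/G; lra.
exists L, (block_functional (n + m) p m q lam a c K); split.
- by rewrite (leq_trans qL0)// /L leq_pmulr// addn_gt0 p0.
- exact: cyl_block_functional.
- by move=> x; apply: block_functional_ge0 => //; exact: ltW.
- apply: le_trans (clower_block_functional_le _ n0 p0 lam0 (ltW a0) c0 K0 lamG') _.
  have -> : eps = eps / 2 + eps / 2 by lra.
  apply: lerD.
    apply: (@le_trans _ _ (\prod_(j < q) (1 - x0))).
      apply: ler_prod => j _; apply/andP; split.
        have : lam * (mean E (fun w => clip c (partial_sum X p w)) - a) <= lam * G.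
          by rewrite ler_wpM2l ?(ltW lam0)// /G; lra.
        by move=> ?; lra.
      rewrite lerD2l lerN2 /x0 ler_wpM2l ?(ltW lam0)//.
      by move: mean_clip; rewrite /a; lra.
    have := prod_one_minus_le q (e := fun=> x0).
    rewrite x01 (ltW x00) => /(_ (fun=> isT)).
    rewrite sumr_const card_ord => h.
    have P0 : 0 <= \prod_(j < q) (1 - x0).
      by apply: prodr_ge0 => j _; rewrite subr_ge0.
    have : (\prod_(j < q) (1 - x0)) * (2 / eps) <= 1.
      by apply: le_trans h; rewrite ler_wpM2l// (le_trans qR)// mulr_natl lerDr.
    by rewrite mulrA ler_pdivrMr//; lra.
  rewrite mulrC ler_pdivrMr//.
  apply: (@le_trans _ _ (q%:R * (eps / (4 * kap) + m%:R * B))).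
    apply: mean_block_error_le => // [|i]; last exact/BP/ltW.
    by apply: cTP (ltW K0); rewrite le_max lexx.
  rewrite -(ler_pM2l kap0) /K.
  have -> : kap * (q%:R * (eps / (4 * kap) + m%:R * B)) =
      q%:R * (eps / 4 + kap * (m%:R * B)) by field; rewrite gt_eqF.
  have -> : kap * (eps / 2 * (L%:R / kap)) = q%:R * (eps / 2 * (p%:R + m%:R)).
    by rewrite LR; field; rewrite gt_eqF.
  rewrite ler_pM2l//; have : eps * 1 <= eps * p%:R by rewrite ler_pM2l.
  have : 0 <= eps * m%:R by rewrite mulr_ge0// ltW.
  by move=> ? ?; lra.
- move=> x Fx; have := block_sum_ge_of_functional lam0 (ltW a0) c0 K0 lamG' Fx.
  apply: le_trans; rewrite -/L -/G.
  have -> : a - 2 * lam * G ^+ 2 = a / 2 by rewrite -mulrA lamG2; lra.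
  have -> : K = delta * L%:R / 16 by rewrite /K /kap; field; rewrite gt_eqF.
  rewrite LR /a.
  have : 0 <= q%:R * (delta * (p%:R - m%:R)).
    by rewrite !mulr_ge0 ?(ltW q0) ?(ltW delta0)// subr_ge0.
  by move=> ?; lra.
Qed.

End frequent_drift.

Section no_drift.
Context {R : realType} {d : measure_display} {Omega : measurableType d}.
Variables (H : set (Omega -> R)) (E : (Omega -> R) -> \bar R).
Variables (m : nat) (X : nat -> Omega -> R) (A : set Omega) (D : R).
Hypotheses (rvH : rv_space H) (subE : sublinear_expectation H E).
Hypotheses (CC : condition_CC H E) (HX : forall n, H (X n)).
Hypotheses (mdepX : m_dependent E m X) (statX : linear_stationary E X).
Hypotheses (A1 : (hatV_star H E A < 1)%E) (D1 : 1 <= D).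
Hypothesis growth : forall w, ~ A w -> exists n0, forall n, (n0 <= n)%N ->
  `|partial_sum X n w| <= D * lil n.

(** Consecutive drifting blocks, each at least as long as everything before it,
    have sums linear in their end point N, while on a path of controlled growth
    a block sum is at most 2 D sqrt (2 N log log N) = o(N). *)
Lemma truncated_mean_limit_le (delta : R) : 0 < delta ->
  exists p1, forall p mu, (p1 <= p)%N ->
    truncated_mean_limit E (partial_sum X p) mu -> mu <= delta * p%:R.
Proof.
move=> delta0; apply: contrapT => nbound.
have D0 : 0 < D := lt_le_trans ltr01 D1.
have [B sumB] := tail_mean_summable rvH subE CC HX mdepX statX A1 D1 growth.
have tailX := uniform_tail_of_summable rvH subE HX D1 sumB.
have freq p1 : exists2 p, (p1 <= p)%N & exists2 mu,
    truncated_mean_limit E (partial_sum X p) mu & delta * p%:R < mu.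
  apply: contrapT => np; apply: nbound; exists p1 => p mu p1p muP.
  rewrite leNgt; apply/negP => mu_gt; apply: np.
  by exists p => //; exists mu.
have block := exists_drifting_block rvH subE HX mdepX statX tailX delta0 freq.
(* As N <= 2 L for the end point N of a block of length L, this constant gives
   2 D sqrt (2 N log log N) <= delta L / 64, below the drift delta L / 32. *)
have [|n1 lil_small] := @lil_little_o R (delta / (256 * D)).
  by rewrite divr_gt0// mulr_gt0.
have /choice[LF LFP] : forall kn : nat * nat, exists LF : nat * ((nat -> R) -> R),
    (0 < kn.2)%N -> [/\ (maxn (kn.2 + m) n1 < LF.1)%N,
      cyl (kn.2 + m) (kn.2 + m + LF.1) LF.2, forall x, 0 <= LF.2 x,
      clower E X LF.2 <= (1 / 2) ^+ kn.1 & forall x, LF.2 x < 1 / 2 ->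
        delta * LF.1%:R / 32 <= block_sum (kn.2 + m) (kn.2 + m + LF.1) x].
  move=> [k [|n]]; first by exists (0%N, fun=> 0).
  have half_gt0 : 0 < (1 / 2 : R) ^+ k by rewrite exprn_gt0.
  have [L [F LF]] := block _ n.+1 (maxn (n.+1 + m) n1) half_gt0 isT.
  by exists (L, F).
pose N := fix N k := if k is k'.+1 then (N k' + m + (LF (k', N k')).1)%N else 1%N.
have N0 k : (0 < N k)%N by case: k => //= k; elim: k => [|k ih] /=; lia.
have NP k := LFP (k, N k) (N0 k).
have N_ge k : (k < N k)%N.
  by elim: k => // k ih; have [+ _ _ _ _] := NP k; rewrite /=; lia.
have [w nAw [K FK]] : exists2 w, ~ A w & exists K, forall k, (K <= k)%N ->
    (LF (k, N k)).2 (path_of X w) < 1 / 2.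
  apply: (avoid_by_blocks rvH subE HX CC mdepX A1 (N := N)
    (F := fun k => (LF (k, N k)).2)) => //.
  - by move=> k /=; have [/= + _ _ _ _] := NP k; lia.
  - by move=> k; have [_ + _ _ _] := NP k.
  - by move=> k; have [_ _ + _ _] := NP k.
  - by move=> k; have [_ _ _ + _] := NP k.
have [n0 nS] := growth nAw.
pose k := maxn K n0; have [/= L_gt _ _ _ blockP] := NP k.
have := blockP _ (FK k (leq_maxl _ _)).
rewrite block_sum_path; move: L_gt; set n := (N k + m)%N; set L := (LF (k, N k)).1.
rewrite gtn_max => /andP[nL n1L]; apply/negP; rewrite -ltNge.
have n0n : (n0 <= n)%N by have := N_ge k; have := leq_maxr K n0; rewrite -/k /n; lia.
have Sn := nS _ n0n; have SnL := nS (n + L)%N (leq_trans n0n (leq_addr _ _)).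
have lil_mono : D * lil n <= D * lil (n + L).
  by rewrite ler_wpM2l ?(ltW D0)// le_lil// leq_addr.
have lilL := lil_small (n + L)%N (leq_trans (ltnW n1L) (leq_addl _ _)).
have nLR : (n + L)%:R <= 2 * L%:R :> R by rewrite -natrM ler_nat mul2n -addnn leq_add2r ltnW.
have L0 : 0 < L%:R :> R by rewrite ltr0n (leq_ltn_trans _ nL).
have small : 2 * (D * lil (n + L)) <= delta * L%:R / 64.
  have -> : delta * L%:R / 64 = 2 * (D * (delta / (256 * D) * (2 * L%:R))).
    by field; rewrite gt_eqF.
  rewrite !ler_wpM2l ?(ltW D0)// (le_trans lilL)// ler_wpM2l//.
  by rewrite divr_ge0 ?mulr_ge0// ltW.
have dL : 0 < delta * L%:R by rewrite mulr_gt0.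
apply: (@le_lt_trans _ _ (`|partial_sum X (n + L) w| + `|partial_sum X n w|)).
  by rewrite (le_trans (ler_norm _))// ler_normB.
by lra.
Qed.

End no_drift.

(** * The Choquet integral and the theorem *)

Section choquet_integral.
Context {R : realType}.

(** Compare with the step function taking on [C i, C (i + 1)) the value of h at
    C i. *)
Lemma integral_nonincreasing_lt_pinfty (h : R -> R) (C B : R) (u : nat -> R) :
  {homo h : x y /~ y <= x} -> (forall t, 0 <= h t) -> 0 < C ->
  (forall i, h (C * i%:R) <= u i) -> (forall I, \sum_(i < I) u i <= B) ->
  (\int[lebesgue_measure]_(t in `[0%R, +oo[) (h t)%:E < +oo)%E.
Proof.
move=> h_mono h0 C0 hu uB.
pose F i := `[C * i%:R, C * i.+1%:R[%classic : set R.
have mh D : measurable D -> measurable_fun D (fun t => (h t)%:E).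
  by move=> mD; apply/measurable_EFinP; exact: nonincreasing_measurable.
have FU : `[0%R, +oo[%classic = \bigcup_i F i :> set R.
  apply/seteqP; split=> t /=.
    rewrite in_itv/= andbT => t0; exists (Num.truncn (t / C)) => //.
    have tC0 : 0 <= t / C by rewrite divr_ge0// ltW.
    rewrite /F/= in_itv/=; apply/andP; split.
      by rewrite mulrC -ler_pdivlMr// truncn_le.
    by rewrite mulrC -ltr_pdivrMr// truncnS_gt.
  move=> [i _]; rewrite /F/= !in_itv/= andbT => /andP[+ _].
  by apply: le_trans; rewrite mulr_ge0// ltW.
have tF : trivIset setT F.
  apply/trivIsetP => i j _ _ ij; apply/seteqP; split=> // t [].
  rewrite /F/= !in_itv/= => /andP[ti ti'] /andP[tj tj'].
  have := le_lt_trans ti tj'; have := le_lt_trans tj ti'.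
  rewrite !ltr_pM2l// !ltr_nat !ltnS => ji ij'.
  by move: ij; rewrite eqn_leq ji ij'.
rewrite FU ge0_integral_bigcup//; last 3 first.
- by move=> i; exact: measurable_itv.
- by apply: mh; rewrite -FU; exact: measurable_itv.
- by move=> t _; rewrite lee_fin.
have intF i : (\int[lebesgue_measure]_(t in F i) (h t)%:E <= (C * u i)%:E)%E.
  apply: (@le_trans _ _ (\int[lebesgue_measure]_(t in F i) (cst (u i)%:E) t)%E).
    apply: ge0_le_integral => //.
    - exact: measurable_itv.
    - by move=> t _; rewrite lee_fin.
    - by apply: mh; exact: measurable_itv.
    - move=> t; rewrite /F/= in_itv/= => /andP[ti _]; rewrite lee_fin.
      by apply: le_trans (hu i); exact: h_mono.
  rewrite integral_cst; last exact: measurable_itv.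
  have muF : lebesgue_measure (F i) = C%:E.
    rewrite /F (lebesgue_measure_itv `[C * i%:R, C * i.+1%:R[)/= lte_fin.
    rewrite ltr_pM2l// ltr_nat ltnSn -EFinD -mulrBr -natr1 addrAC subrr add0r.
    by rewrite mulr1.
  by rewrite [X in (_ * X)%E]muF muleC EFinM.
apply: le_lt_trans (ltry (C * B)); apply: lime_le.
  apply: is_cvg_nneseries => i _ _; apply: integral_ge0 => t _.
  by rewrite lee_fin.
exists 0%N => // I _ /=; apply: (@le_trans _ _ (\sum_(0 <= i < I) (C * u i)%:E)%E).
  by apply: lee_sum => i _; exact: intF.
by rewrite sumEFin lee_fin -mulr_sumr ler_wpM2l ?(ltW C0)// big_mkord.
Qed.

Lemma measurable_loglogM : measurable_fun setT (fun x : R => logM (logM x)).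
Proof.
apply: nondecreasing_measurable => // x y xy; exact/le_logM/le_logM.
Qed.

Lemma cvg_fine_to0 (a : nat -> \bar R) (r : nat -> R) :
  (forall n, (0 < n)%N -> a n = (r n)%:E) ->
  (forall eps, 0 < eps -> exists n1, forall n, (n1 <= n)%N -> `|r n| <= eps) ->
  a n @[n --> \oo] --> 0%E.
Proof.
move=> ar r_small; apply/fine_cvgP; split.
  by exists 1%N => // n /= n0; rewrite ar.
apply/cvgrPdist_le => eps /r_small[n1 n1P]; exists n1.+1 => // n /= n1n.
by rewrite ar ?(leq_ltn_trans _ n1n)// sub0r normrN n1P// ltnW.
Qed.

End choquet_integral.

Section choquet_finite.
Context {R : realType} {d : measure_display} {Omega : measurableType d}.
Variables (H : set (Omega -> R)) (E : (Omega -> R) -> \bar R).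
Variables (V : set Omega -> R) (m : nat) (X : nat -> Omega -> R) (D B : R).
Hypotheses (rvH : rv_space H) (subE : sublinear_expectation H E).
Hypotheses (capV : subadditive_capacity V) (compV : capacity_compatible H E V).
Hypotheses (HX : forall n, H (X n)) (D1 : 1 <= D).
Hypothesis sumB : forall I, \sum_(0 <= i < I) tail_mean E m X D i <= B.

(** For C = 64 D^2 (m + 1), the event X_1^2 / log log |X_1| >= C (i + 1) lies in
    the event where |X_1| is at least twice the i-th threshold, whose capacity is
    at most the i-th term of the convergent series. *)
Lemma choquet_lt_pinfty :
  (choquet V (fun w => X 0%N w ^+ 2 / logM (logM `|X 0%N w|))%R < +oo)%E.
Proof.
pose g w := X 0%N w ^+ 2 / logM (logM `|X 0%N w|).
have D1' := D1.
have t0 i : 0 < threshold m D i.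
  by rewrite /threshold !mulr_gt0 ?lil_gt0 ?muln_gt0//; lra.
have LL_gt0 w : 0 < logM (logM `|X 0%N w|).
  by apply: lt_le_trans (logM_ge1 _).
have g0 w : 0 <= g w by rewrite divr_ge0 ?sqr_ge0// ltW.
have mX : measurable_fun setT (X 0%N) := rv_space_measurable rvH (HX 0).
have mLL : measurable_fun setT (fun w => logM (logM `|X 0%N w|)).
  apply: (measurableT_comp measurable_loglogM).
  by apply: (measurableT_comp (@normr_measurable _ _)).
have mg t : measurable [set w | t <= g w].
  have mf : measurable_fun setT
      (fun w => X 0%N w ^+ 2 - t * logM (logM `|X 0%N w|)).
    apply: measurable_funB; first exact: measurable_funX.
    by apply: measurable_funM => //; exact: measurable_cst.
  have := mf measurableT _ (measurable_itv `[0%R, +oo[).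
  rewrite setTI; congr measurable; apply/seteqP; split=> w /=.
    by rewrite in_itv/= andbT subr_ge0 /g ler_pdivlMr.
  by rewrite in_itv/= andbT subr_ge0 /g ler_pdivlMr.
have V01 t : 0 <= V [set w | t <= g w] <= 1 := capacity_bounds capV (mg t).
rewrite /choquet.
rewrite [X in (_ + X)%E]integral0_eq; last first.
  move=> t /=; rewrite in_itv/= => t_le0.
  rewrite (_ : [set w | t <= _] = setT) ?(capacity_setT capV) ?subrr//.
  by apply/seteqP; split=> // w _ /=; exact: le_trans (g0 w).
rewrite adde0.
pose C := 4 * (4 * D) ^+ 2 * m.+1%:R.
have C0 : 0 < C by rewrite !mulr_gt0//; lra.
(* The step at 0 is bounded by the total capacity 1, hence the shift of the series. *)
pose u i := if i is i'.+1 then tail_mean E m X D i' else 1.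
apply: (integral_nonincreasing_lt_pinfty (C := C) (u := u) (B := 1 + B)) => //.
- move=> s t st; apply: (capacity_monotone capV) => // w /=.
  exact: le_trans.
- by move=> t; have /andP[] := V01 t.
- move=> [|i] /=; first by have /andP[] := V01 (C * 0%:R).
  have bT := bounded_comp rvH (bLip_soft_tail (t0 i)) (HX 0).
  rewrite -lee_fin -(mean_fin rvH subE bT).
  apply: (compV (f := fun=> 0) (mg _) (rv_cst rvH 0) bT.1 _ _).2 => w.
    by rewrite indicE.
  rewrite indicE; have [/set_mem/= gw|_] := boolP (w \in _); last first.
    exact: soft_tail_ge0.
  rewrite soft_tail_eq1// /threshold.
  have -> : 2 * (2 * D * lil (m.+1 * i.+1)) = 4 * D * lil (m.+1 * i.+1) by ring.
  apply: le_of_sqr_div_loglog; [lra|by rewrite muln_gt0|].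
  by rewrite natrM mulrA.
- move=> [|I]; last first.
    rewrite big_ord_recl/= lerD2l; apply: le_trans (sumB I).
    by rewrite big_mkord.
  rewrite big_ord0; have := sumB 0; rewrite big_geq// => ?; lra.
Qed.

End choquet_finite.

Theorem theorem3p4 (R : realType) (d : measure_display)
    (Omega : measurableType d) (H : set (Omega -> R))
    (E : (Omega -> R) -> \bar R) (V : set Omega -> R)
    (m : nat) (X : nat -> Omega -> R) (M : R)
    (rvH : rv_space H)
    (subE : sublinear_expectation H E)
    (CC : condition_CC H E)
    (capV : subadditive_capacity V)
    (compV : capacity_compatible H E V)
    (HX : forall n, H (X n))
    (mdepX : m_dependent E m X)
    (statX : linear_stationary E X)
    (limsup_lt1 :
      (hatV_star H E
        [set w | M%:E <= limn_esup (fun n : nat =>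
           (`|partial_sum X n w|
             / Num.sqrt (2 * n%:R * logM (logM n%:R)))%:E)] < 1)%E) :
  (choquet V (fun w => X 0%N w ^+ 2 / logM (logM `|X 0%N w|))%R < +oo)%E /\
  (forall n : nat, (0 < n)%N ->
     has_breveE E (partial_sum X n) /\
     has_breveE E (fun w => - partial_sum X n w)) /\
  ((breveE E (partial_sum X n) * (n%:R^-1)%:E)%E @[n --> \oo] --> 0%E) /\
  ((breve_calE E (partial_sum X n) * (n%:R^-1)%:E)%E @[n --> \oo] --> 0%E).
Proof.
set A := [set w | _] in limsup_lt1.
pose D := Num.max M 1; have D1 : 1 <= D by rewrite le_max lexx orbT.
have growth w : ~ A w -> exists n0, forall n, (n0 <= n)%N ->
    `|partial_sum X n w| <= D * lil n.
  move=> /eventually_lt_of_limn_esup[n0 n0P]; exists (maxn n0 1) => n.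
  rewrite geq_max => /andP[/n0P + n1]; rewrite lte_fin ltr_pdivrMr ?lil_gt0//.
  move=> /ltW/le_trans; apply; rewrite ler_wpM2r ?lil_ge0//.
  by rewrite le_max lexx.
have [B sumB] := tail_mean_summable rvH subE CC HX mdepX statX limsup_lt1 D1 growth.
have tailX := uniform_tail_of_summable rvH subE HX D1 sumB.
pose X' i w := - X i w.
have HX' n : H (X' n).
  rewrite (_ : X' n = fun w => -1 * X n w); first exact: rv_space_scale.
  by apply: funext => w; rewrite mulN1r.
have growth' w : ~ A w -> exists n0, forall n, (n0 <= n)%N ->
    `|partial_sum X' n w| <= D * lil n.
  by move=> /growth[n0 n0P]; exists n0 => n; rewrite partial_sumN normrN; exact: n0P.
have tailS n : (0 < n)%N -> uniform_tail E (partial_sum X n).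
  by move=> n0; exact: (uniform_tail_partial_sum rvH subE).
have /choice[mu muP] : forall n, exists mu, (0 < n)%N ->
    truncated_mean_limit E (partial_sum X n) mu /\
    (E (truncate c (partial_sum X n)) @[c --> +oo%R] --> mu%:E).
  move=> [|n]; first by exists 0.
  have [mu muP] := truncated_mean_cvg rvH subE (rv_partial_sum rvH HX _) (tailS n.+1 isT).
  by exists mu.
have /choice[nu nuP] : forall n, exists nu, (0 < n)%N ->
    truncated_mean_limit E (fun w => - partial_sum X n w) nu /\
    (E (truncate c (fun w => - partial_sum X n w)) @[c --> +oo%R] --> nu%:E).
  move=> [|n]; first by exists 0.
  have HS : H (fun w => - partial_sum X n.+1 w).
    by rewrite -partial_sumN; exact: rv_partial_sum.
  have [nu nuP] := truncated_mean_cvg rvH subE HS (uniform_tailN (tailS n.+1 isT)).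
  by exists nu.
have mean_small eps : 0 < eps -> exists n1, forall n, (n1 <= n)%N ->
    `|mu n / n%:R| <= eps /\ `|- nu n / n%:R| <= eps.
  move=> eps0.
  have [p1 p1P] := truncated_mean_limit_le rvH subE CC HX mdepX statX
    limsup_lt1 D1 growth eps0.
  have [p2 p2P] := truncated_mean_limit_le rvH subE CC HX' (m_dependentN mdepX)
    (linear_stationaryN statX) limsup_lt1 D1 growth' eps0.
  exists (maxn 1 (maxn p1 p2)) => n; rewrite !geq_max => /and3P[n0 p1n p2n].
  have [muL _] := muP n n0; have [nuL _] := nuP n n0.
  have nR : 0 < n%:R :> R by rewrite ltr0n.
  have := p1P n (mu n) p1n muL; have := p2P n (nu n) p2n.
  rewrite partial_sumN => /(_ nuL) nu_le mu_le.
  have := truncated_mean_limit_add_ge0 rvH subE (rv_partial_sum rvH HX n) muL nuL.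
  move=> munu; rewrite !normrM !normfV normrN (gtr0_norm nR) !ler_pdivrMr// !ler_norml.
  by split; apply/andP; split; lra.
split; first exact: (choquet_lt_pinfty rvH subE capV compV HX D1 sumB).
split=> [n n0|].
  split; apply/cvg_ex; first by exists (mu n)%:E; exact: (muP n n0).2.
  by exists (nu n)%:E; exact: (nuP n n0).2.
split.
  apply: (cvg_fine_to0 (r := fun n => mu n / n%:R)) => [n n0|eps /mean_small[n1 n1P]].
    by rewrite /breveE (cvg_lim _ (muP n n0).2).
  by exists n1 => n /n1P[].
apply: (cvg_fine_to0 (r := fun n => - nu n / n%:R)) => [n n0|eps /mean_small[n1 n1P]].
  by rewrite /breve_calE /breveE (cvg_lim _ (nuP n n0).2).
by exists n1 => n /n1P[].
Qed.
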